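(* Let $0<\alpha_1<\alpha_2$, $\beta\ge 1$, $T\ge 2\ln 2$, and let the guidance parameter $w>e$ satisfy $$\frac{\ln w}{16\sqrt w}\le \frac{\alpha_1\alpha_2}{\beta}\qquad\text{and}\qquad \frac{\ln w}{\ln\ln w}\ge 1024\Bigl(\frac{\alpha_2}{\min(\alpha_1,1)}\Bigr)^2 .$$ Run the guided probability flow ODE (defined in the context) with parameter $w$ for the mixture $p=\frac12p^{(1)}+\frac12p^{(-1)}$, from the initialization $x(0)\sim\mathcal N(0,1)$. Then with probability at least $1-\exp\bigl(-\frac{w\alpha_1^2}{512\beta^2}\bigr)$ the output sample $x(T)=\tilde x(1)$ lies in the interval $$\Bigl(\alpha_2\Bigl(1-\frac{32}{\sqrt{\ln w}}\Bigr),\ \alpha_2\Bigr).$$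
   Context: Let $0<\alpha_1<\alpha_2$ and $\beta\ge1$. Let $p^{(1)}$ and $p^{(-1)}$ be probability densities on $\mathbb R$ supported on $[\alpha_1,\alpha_2]$ and $[-\alpha_2,-\alpha_1]$ respectively, which are $\beta$-bounded with respect to each other: $\frac1\beta\le \frac{p^{(-1)}(x_1)}{p^{(1)}(x_2)}\le\beta$ for all $x_1\in(-\alpha_2,-\alpha_1)$, $x_2\in(\alpha_1,\alpha_2)$. Let $p=\frac12p^{(1)}+\frac12p^{(-1)}$, and let $(X_0,z)$ be jointly distributed with $z$ uniform on $\{\pm1\}$ and $X_0\mid z\sim p^{(z)}$. Fix $T>0$; for $t\in[0,T]$ put $a_t=e^{t-T}$, $b_t=\sqrt{1-a_t^2}$, and $X_t=a_tX_0+\xi_t$ with $\xi_t\sim\mathcal N(0,b_t^2)$ independent of $(X_0,z)$. Let $p_t$ denote the density of $X_t$ and $p_t(\cdot\mid z=\pm1)$ the conditional density of $X_t$ given $z=\pm1$. For a guidance parameter $w\ge0$, the guided probability flow ODE (guided toward class $z=1$) is $$x'(t)=x(t)+(w+1)\nabla\log p_t(x(t)\mid z=1)-w\nabla\log p_t(x(t)),\qquad t\in[0,T),$$ with $x(0)\sim\mathcal N(0,1)$; the output sample is $x(T)=\lim_{t\to T}x(t)$. Reparametrize time by $s=a_t=e^{t-T}\in[e^{-T},1]$ and write $\tilde x(s)=x(T+\ln s)$, so $\tilde x(1)=x(T)$. *)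

(* Defs.v *)
From HB Require Import structures.
From mathcomp Require Import all_boot all_order all_algebra.
From mathcomp Require Import all_classical all_reals all_analysis.
Set Implicit Arguments. Unset Strict Implicit. Unset Printing Implicit Defensive.
Import Order.TTheory GRing.Theory Num.Def Num.Theory.
Import numFieldNormedType.Exports.
Local Open Scope classical_set_scope.
Local Open Scope ring_scope.

Section defs.
Context {R : realType}.

Definition is_density (q : R -> R) : Prop :=
  measurable_fun setT q /\ (forall x, 0 <= q x) /\
  (\int[lebesgue_measure]_x (q x)%:E = 1)%E.

Definition supported_on (q : R -> R) (lo hi : R) : Prop :=
  forall x, ~ (lo <= x <= hi) -> q x = 0.

Definition beta_bounded (pm1 p1 : R -> R) (a1 a2 beta : R) : Prop :=
  forall x1 x2, - a2 < x1 < - a1 -> a1 < x2 < a2 ->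
    beta^-1 <= pm1 x1 / p1 x2 <= beta.

Definition a_ (T t : R) : R := expR (t - T).
Definition b_ (T t : R) : R := Num.sqrt (1 - a_ T t ^+ 2).

(* density of X_t = a_t X_0 + xi_t, xi_t ~ N(0, b_t^2), when X_0 has density q *)
Definition noised_density (q : R -> R) (T t : R) (x : R) : R :=
  Rintegral lebesgue_measure setT
    (fun y => q y * normal_pdf (a_ T t * y) (b_ T t) x).

Definition mixture_noised_density (p1 pm1 : R -> R) (T t x : R) : R :=
  2^-1 * noised_density p1 T t x + 2^-1 * noised_density pm1 T t x.

Definition score (f : R -> R) (x : R) : R := derive1 (fun y => ln (f y)) x.

Definition guided_field (p1 pm1 : R -> R) (T w t x : R) : R :=
  x + (w + 1) * score (noised_density p1 T t) x
    - w * score (mixture_noised_density p1 pm1 T t) x.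

Definition guided_flow (p1 pm1 : R -> R) (T w : R) (xs : R -> R -> R) : Prop :=
  forall x0,
    xs x0 0 = x0 /\
    {within `[0, T[, continuous (xs x0)} /\
    (forall t, 0 < t < T ->
       is_derive t 1 (xs x0) (guided_field p1 pm1 T w t (xs x0 t))).

End defs.

(* Main.v *)
(* In the coordinates [u = x / b_t] and [v = a_t / b_t] the guided flow reads
   [du/dv = m1 + w D], where [m1] is the posterior mean of [X_0] under [p1] and
   the guidance [D >= 0] is comparable to the posterior weight of class [-1].
   The unguided flow [du/dv = m1] transports the law of [v X_0 + Z], [Z] standard
   normal, so it preserves the exceedance probability
   [S = P(v X_0 + Z > u)] under [p1]; guidance can only decrease [S].
   As [v] tends to infinity, [S] tends to [P(X_0 > l)] with [l = lim u/v = x(T)].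
   - The limit exists because [S] converges and [r |-> P(X_0 > r)] is strictly
     decreasing on [[a1, a2]]; [l < a2] because [S] stays bounded away from [0],
     the guidance decaying like [exp(- 2 a1 u v)].
   - While [2 a2 u v <= ln w / 2] the guidance is at least [a1 sqrt w / beta], so
     from [x(0) > - a1 sqrt w / (16 beta)] the value [u = 5 ln w / (48 a2)] is
     reached before [v = 12/5]. There [S <= w^-5], and since
     [P(X_0 > l) >= (a2 - l) / (beta (a2 - a1))], [l] is close to [a2].
   If [ln w < 1024] the lower end of the target interval is negative. *)
Require Import Defs.
From HB Require Import structures.
From mathcomp Require Import all_boot all_order all_algebra.
From mathcomp Require Import all_classical all_reals all_analysis measurable_realfun.
From mathcomp Require Import ring lra.
Set Implicit Arguments. Unset Strict Implicit. Unset Printing Implicit Defensive.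
Import Order.TTheory GRing.Theory Num.Def Num.Theory.
Import numFieldNormedType.Exports.
Local Open Scope classical_set_scope.
Local Open Scope ring_scope.

(** * Calculus and Gaussian tails *)

Section calculus.
Context {R : realType}.
Implicit Types (f g F : R -> R) (x y C : R).

Lemma is_derive_continuous f (df : R -> R) :
  (forall x, is_derive x 1 f (df x)) -> continuous f.
Proof.
by move=> dfx x; apply/differentiable_continuous/derivable1_diffP; case: (dfx x).
Qed.

Lemma mean_value_bound f g C :
  (forall x, is_derive x 1 f (g x)) -> (forall x, `|g x| <= C) ->
  forall x y, `|f y - f x| <= C * `|y - x|.
Proof.
move=> dfg gC x y; wlog xy : x y / x <= y => [hw|].
  by have [/hw//|/ltW/hw] := leP x y; rewrite distrC (distrC x).
have [|z _ ->] := @MVT_segment _ f g x y xy (fun z _ => dfg z).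
  exact/continuous_subspaceT/(is_derive_continuous dfg).
by rewrite normrM ler_wpM2r.
Qed.

(** The mean value theorem turns [F y - F x] into [f z * (y - x)] with [z] between [x] and [y], and
    [mean_value_bound] controls [f z - f x]. Only the quadratic order matters later, so the factor
    [1/2] is given up. *)
Lemma taylor2_bound F f g C :
  (forall x, is_derive x 1 F (f x)) -> (forall x, is_derive x 1 f (g x)) ->
  (forall x, `|g x| <= C) ->
  forall x y, `|F y - F x - f x * (y - x)| <= C * (y - x) ^+ 2.
Proof.
move=> dF df gC x y.
have fC := mean_value_bound df gC.
have C0 : 0 <= C := le_trans (normr_ge0 _) (gC 0).
have key a b (ab : a <= b) : exists2 z, a <= z <= b & F b - F a = f z * (b - a).
  have [|z zab ->] := @MVT_segment _ F f a b ab (fun z _ => dF z).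
    exact/continuous_subspaceT/(is_derive_continuous dF).
  by exists z => //; move: zab; rewrite in_itv.
have [z zx ->] : exists2 z, `|z - x| <= `|y - x| & F y - F x = f z * (y - x).
  have [xy|/ltW yx] := leP x y.
    have [z /andP[xz zy] ->] := key _ _ xy; exists z => //.
    by rewrite !ger0_norm ?subr_ge0// lerD2r.
  have [z /andP[yz zx] e] := key _ _ yx; exists z.
    by rewrite !ler0_norm ?subr_le0// !opprB lerD2l lerN2.
  by rewrite -[LHS]opprB e -mulrN opprB.
rewrite -mulrBl normrM -(real_normK (num_real (y - x))) expr2 mulrA ler_wpM2r//.
by apply: (le_trans (fC _ _)); rewrite ler_wpM2l.
Qed.

(** A derivative is asked for only inside the segment, to allow segments starting at time [0], where
    a trajectory is known to be continuous but not differentiable. *)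
Lemma is_derive_ge0_le f (df : R -> R) a b : a <= b ->
  {within `[a, b], continuous f} ->
  (forall x, a < x < b -> is_derive x 1 f (df x)) ->
  (forall x, a < x < b -> 0 <= df x) -> f a <= f b.
Proof.
move=> ab cf dfx df0.
move: ab; rewrite le_eqVlt => /predU1P[->//|ab].
have dfx' x : x \in `]a, b[ -> is_derive x 1 f (df x) by rewrite in_itv => /dfx.
have [z] := @MVT _ f df a b ab dfx' cf.
rewrite in_itv /= => zab e; rewrite -subr_ge0 e mulr_ge0 ?df0//.
by rewrite subr_ge0 ltW.
Qed.

Lemma expR_ge_sqr x : 0 <= x -> x ^+ 2 <= expR (2 * x).
Proof.
move=> x0; rewrite mulrC expRM_natr ler_pXn2r ?nnegrE ?expR_ge0//.
by apply: le_trans (expR_ge1Dx x); rewrite lerDr.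
Qed.

End calculus.

Section gauss.
Context {R : realType}.
Implicit Types x y m c : R.
Notation mu := (@lebesgue_measure R).

Definition gpdf (x : R) : R := normal_pdf 0 1 x.

Lemma gpdfE x : gpdf x = normal_peak 1 * expR (- x ^+ 2 / 2).
Proof.
by rewrite /gpdf normal_pdfE ?oner_eq0// /normal_fun subr0 expr1n.
Qed.

Lemma gpdf_gt0 x : 0 < gpdf x.
Proof. by rewrite gpdfE mulr_gt0 ?expR_gt0 ?normal_peak_gt0// oner_eq0. Qed.

Lemma gpdf_ge0 x : 0 <= gpdf x.
Proof. exact/ltW/gpdf_gt0. Qed.

Lemma gpdfN x : gpdf (- x) = gpdf x.
Proof. by rewrite !gpdfE sqrrN. Qed.

Lemma normal_pdf_gpdf m (b : R) x : 0 < b ->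
  normal_pdf m b x = b^-1 * gpdf ((m - x) / b).
Proof.
move=> b0; rewrite gpdfE normal_pdfE ?gt_eqF// /normal_peak /normal_fun.
rewrite expr1n mul1r -mulrnAr sqrtrM ?sqr_ge0// sqrtr_sqr gtr0_norm//.
rewrite invfM -mulrA; congr (_ * (_ * expR _)).
by field; rewrite gt_eqF.
Qed.

Lemma is_derive_gpdf x : is_derive x 1 gpdf (- x * gpdf x).
Proof.
have -> : gpdf = (fun y => normal_peak 1 * expR (- y ^+ 2 / 2)).
  by apply/funext => y; rewrite gpdfE.
apply: is_derive_eq.
by rewrite /GRing.scale /=; field.
Qed.

Lemma is_derive_gpdf2 x :
  is_derive x 1 (fun y => - y * gpdf y) ((x ^+ 2 - 1) * gpdf x).
Proof.
have dg := is_derive_gpdf x.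
apply: is_derive_eq.
by rewrite /GRing.scale /=; ring.
Qed.

Lemma continuous_gpdf : continuous gpdf.
Proof. exact/is_derive_continuous/is_derive_gpdf. Qed.

(** This follows from [1 + y <= expR y] at [y = x ^+ 2 / 2]. It bounds the first two derivatives of
    [gpdf], as differentiation under [mean] requires. *)
Lemma gpdf_sqr_bound x : (1 + x ^+ 2) * gpdf x <= 2 * normal_peak 1.
Proof.
rewrite gpdfE mulrCA mulrC ler_wpM2r ?normal_peak_ge0// mulNr expRN.
rewrite ler_pdivrMr ?expR_gt0//.
have := expR_ge1Dx (x ^+ 2 / 2); lra.
Qed.

Lemma gpdf_lin_bound x : `|- x * gpdf x| <= 2 * normal_peak 1.
Proof.
rewrite normrM normrN (gtr0_norm (gpdf_gt0 _)).
apply: le_trans (gpdf_sqr_bound x).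
rewrite ler_wpM2r ?gpdf_ge0// -(real_normK (num_real x)).
by have := sqr_ge0 (`|x| - 1); have := normr_ge0 x; nra.
Qed.

Lemma gpdf2_bound x : `|(x ^+ 2 - 1) * gpdf x| <= 2 * normal_peak 1.
Proof.
rewrite normrM (gtr0_norm (gpdf_gt0 _)).
apply: le_trans (gpdf_sqr_bound x).
rewrite ler_wpM2r ?gpdf_ge0// ler_norml.
by have := sqr_ge0 x; lra.
Qed.

Definition gcdf (x : R) : R := Rintegral mu `]-oo, x] gpdf.

Lemma integrable_gpdf (A : set R) : measurable A ->
  mu.-integrable A (EFin \o gpdf).
Proof.
move=> mA; apply: (integrableS measurableT) => //.
exact: integrable_normal_pdf.
Qed.

Lemma gcdfE x : (gcdf x)%:E = normal_prob 0 1 `]-oo, x].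
Proof.
rewrite /gcdf /Rintegral fineK//.
exact/integrable_fin_num/integrable_gpdf.
Qed.

Lemma gcdf_ge0 x : 0 <= gcdf x.
Proof. by apply: Rintegral_ge0 => y _; rewrite gpdf_ge0. Qed.

Lemma gcdf_le1 x : gcdf x <= 1.
Proof. by rewrite -lee_fin gcdfE; exact: probability_le1. Qed.

Lemma is_derive_gcdf x : is_derive x 1 gcdf (gpdf x).
Proof.
have xx : x < x + 1 by rewrite ltrDl.
have ig : mu.-integrable `]-oo, x + 1] (EFin \o gpdf) by exact: integrable_gpdf.
have [d e] := @continuous_FTC1 R gpdf -oo%O x (x + 1) xx ig (ltNyr x) (@continuous_gpdf x).
have /derivableP dg := d; apply: (is_derive_eq dg).
by rewrite -derive1E e.
Qed.

Lemma continuous_gcdf : continuous gcdf.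
Proof. exact/is_derive_continuous/is_derive_gcdf. Qed.

Lemma gcdf_le x y : x <= y -> gcdf x <= gcdf y.
Proof.
move=> xy; apply: (@is_derive_ge0_le _ gcdf gpdf) => //.
- exact/continuous_subspaceT/continuous_gcdf.
- by move=> z _; exact: is_derive_gcdf.
- by move=> z _; rewrite gpdf_ge0.
Qed.

Lemma gcdf_lt x y : x < y -> gcdf x < gcdf y.
Proof.
move=> xy; have cg : {within `[x, y], continuous gcdf}.
  exact/continuous_subspaceT/continuous_gcdf.
have [z _ e] := @MVT _ gcdf gpdf x y xy (fun z _ => is_derive_gcdf z) cg.
by rewrite -subr_gt0 e mulr_gt0 ?gpdf_gt0 ?subr_gt0.
Qed.

Lemma gcdf_lt1 x : gcdf x < 1.
Proof. by apply: lt_le_trans (gcdf_le1 (x + 1)); rewrite gcdf_lt// ltrDl. Qed.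

(* On [A] the density of [N(0,1)] is at most [exp(-m^2/2)] times that of [N(m,1)]. *)
Lemma normal_prob_chernoff m (A : set R) : measurable A ->
  (forall x, A x -> m ^+ 2 <= x * m) ->
  (normal_prob 0 1 A <= (expR (- m ^+ 2 / 2))%:E)%E.
Proof.
move=> mA Am.
apply: (@le_trans _ _ (\int[mu]_(x in A) ((expR (- m ^+ 2 / 2))%:E * (normal_pdf m 1 x)%:E))%E).
  apply: ge0_le_integral => //=.
  - by move=> x _; rewrite lee_fin normal_pdf_ge0.
  - apply/measurable_EFinP; apply: measurable_funTS; exact: measurable_normal_pdf.
  - apply: emeasurable_funM; first exact: measurable_cst.
    apply/measurable_EFinP; apply: measurable_funTS; exact: measurable_normal_pdf.
  move=> x /Am xm; rewrite -EFinM lee_fin !normal_pdf_gpdf// !invr1 !mul1r !mulr1.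
  rewrite !gpdfE mulrCA -expRD ler_wpM2l ?normal_peak_ge0// ler_expR.
  by nra.
rewrite integralZl//; last first.
  by apply: (integrableS measurableT) => //; exact: integrable_normal_pdf.
rewrite -[leRHS]mule1 lee_wpmul2l ?lee_fin ?expR_ge0//.
exact: (@probability_le1 _ _ _ (normal_prob m 1)).
Qed.

Lemma gcdfN_le x : 0 <= x -> gcdf (- x) <= expR (- x ^+ 2 / 2).
Proof.
move=> x0; rewrite -lee_fin gcdfE -[x ^+ 2]sqrrN normal_prob_chernoff//.
by move=> y /=; rewrite in_itv /= => yx; nra.
Qed.

Lemma gcdf_ge x : 0 <= x -> 1 - expR (- x ^+ 2 / 2) <= gcdf x.
Proof.
move=> x0; rewrite -lee_fin gcdfE.
have -> : [set` `]-oo, x]] = ~` [set` `]x, +oo[] :> set R by rewrite setCitvr.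
rewrite probability_setC// EFinB leeB//.
apply: normal_prob_chernoff => // y /=.
by rewrite in_itv /= andbT => yx; nra.
Qed.

(* Integrate the density over a step of length [1/(1+|x|)] to the left of [x]. *)
Lemma gpdf_le_gcdf x : gpdf x <= expR (3 / 2) * (1 + `|x|) * gcdf x.
Proof.
set h := (1 + `|x|)^-1.
have X0 := normr_ge0 x.
have h0 : 0 < h by rewrite invr_gt0; lra.
have hx : h * (1 + `|x|) = 1 by rewrite mulVf//; lra.
have xh : x - h < x by rewrite ltrBlDr ltrDl.
have cg : {within `[x - h, x], continuous gcdf}.
  exact/continuous_subspaceT/continuous_gcdf.
have [z] := @MVT _ gcdf gpdf (x - h) x xh (fun z _ => is_derive_gcdf z) cg.
move=> /[!in_itv]/= /andP[z1 z2]; rewrite opprB addrCA subrr addr0 => e.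
have gz : expR (- (3 / 2)) * gpdf x <= gpdf z.
  rewrite !gpdfE mulrCA -expRD ler_wpM2l ?normal_peak_ge0// ler_expR.
  have zx : `|z - x| <= h by rewrite ler_norml; lra.
  have d0 := normr_ge0 (z - x).
  have h1 : h <= 1 by nra.
  have : `|z - x| * `|x| <= 1 by nra.
  have : (z - x) * x <= `|z - x| * `|x| by rewrite -normrM ler_norm.
  have : (z - x) ^+ 2 <= 1 by rewrite -(real_normK (num_real (z - x))); nra.
  nra.
have : gpdf z * h <= gcdf x by rewrite -e gerBl gcdf_ge0.
rewrite -mulrA -ler_pdivrMl ?expR_gt0// -expRN => H.
apply: (le_trans gz).
have -> : gpdf z = (1 + `|x|) * (gpdf z * h) by rewrite mulrCA (mulrC _ h) hx mulr1.
by rewrite ler_wpM2l// addr_ge0.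
Qed.

End gauss.

(** * Expectations under a compactly supported density *)

Section mean.
Context {R : realType}.
Implicit Types (p k : R -> R) (lo hi : R).
Notation mu := (@lebesgue_measure R).

Definition mean p k : R := Rintegral mu setT (fun y => p y * k y).

(** Measurable on the whole line but bounded only on [[lo, hi]]: this makes [p * k] integrable for a
    density [p] supported there, and admits unbounded [k] such as the identity. *)
Definition bounded_on lo hi k : Prop :=
  measurable_fun setT k /\ exists M, forall y, lo <= y <= hi -> `|k y| <= M.

Lemma bounded_on_continuous lo hi k : lo <= hi -> continuous k -> bounded_on lo hi k.
Proof.
move=> lohi ck; split; first exact: continuous_measurable_fun.
have cn : {within `[lo, hi], continuous (fun y => `|k y|)}.
  by apply: continuous_subspaceT => y; apply: continuous_comp; [exact: ck|exact: norm_continuous].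
have [c _ cM] := EVT_max lohi cn.
by exists `|k c| => y ylh; apply: cM; rewrite in_itv.
Qed.

Lemma bounded_on_indic lo hi (A : set R) : measurable A -> bounded_on lo hi \1_A.
Proof.
move=> mA; split; first exact: measurable_indic.
by exists 1 => y _; rewrite indicE; case: (y \in A); rewrite ?normr1 ?normr0.
Qed.

Lemma bounded_on_cst lo hi c : bounded_on lo hi (fun _ => c).
Proof. by split; [exact: measurable_cst|exists `|c|]. Qed.

Lemma bounded_onD lo hi k k' : bounded_on lo hi k -> bounded_on lo hi k' ->
  bounded_on lo hi (fun y => k y + k' y).
Proof.
move=> [mk [M kM]] [mk' [M' kM']]; split; first exact: measurable_funD.
by exists (M + M') => y ylh; rewrite (le_trans (ler_normD _ _))// lerD ?kM ?kM'.
Qed.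

Lemma bounded_onZ lo hi c k : bounded_on lo hi k -> bounded_on lo hi (fun y => c * k y).
Proof.
move=> [mk [M kM]]; split; first exact: measurable_funM.
by exists (`|c| * M) => y ylh; rewrite normrM ler_wpM2l// kM.
Qed.

End mean.

Section mean_density.
Context {R : realType} (p : R -> R) (lo hi : R).
Context (dp : is_density p) (sp : supported_on p lo hi) (lohi : lo <= hi).
Implicit Types (k : R -> R).
Notation mu := (@lebesgue_measure R).

Let p0 x : 0 <= p x. Proof. by case: dp => _ []. Qed.

Lemma integrable_density : mu.-integrable setT (EFin \o p).
Proof.
case: dp => mp [_ ip]; apply/integrableP; split; first exact/measurable_EFinP.
under eq_integral do rewrite /= ger0_norm ?p0//.
by rewrite ip ltry.
Qed.

Lemma integrable_mean k : bounded_on lo hi k ->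
  mu.-integrable setT (EFin \o (fun y => p y * k y)).
Proof.
move=> [mk [M kM]].
apply: (@le_integrable _ _ _ mu setT measurableT _ (EFin \o (fun y => M * p y))).
- apply/measurable_EFinP; apply: measurable_funM => //; by case: dp.
- move=> y _ /=; rewrite lee_fin normrM (ger0_norm (p0 y)) mulrC.
  have [ylh|ylh] := pselect (lo <= y <= hi); last by rewrite sp// !mulr0 normr0.
  by rewrite (le_trans _ (ler_norm _))// ler_wpM2r ?kM.
- have -> : EFin \o (fun y => M * p y) = (fun y => M%:E * (EFin \o p) y)%E.
    by apply/funext => y /=; rewrite EFinM.
  apply: integrableZl => //; exact: integrable_density.
Qed.

Lemma meanD k k' : bounded_on lo hi k -> bounded_on lo hi k' ->
  mean p (fun y => k y + k' y) = mean p k + mean p k'.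
Proof.
move=> bk bk'; rewrite /mean -RintegralD//; try exact: integrable_mean.
by congr fine; apply: eq_integral => y _; rewrite mulrDr.
Qed.

Lemma meanZ c k : bounded_on lo hi k -> mean p (fun y => c * k y) = c * mean p k.
Proof.
move=> bk; rewrite /mean -RintegralZl//; last exact: integrable_mean.
by congr fine; apply: eq_integral => y _; rewrite mulrCA.
Qed.

Lemma meanB k k' : bounded_on lo hi k -> bounded_on lo hi k' ->
  mean p (fun y => k y - k' y) = mean p k - mean p k'.
Proof.
move=> bk bk'; rewrite -[X in _ = _ + X]mulN1r -meanZ// -meanD//; last exact: bounded_onZ.
by congr mean; apply/funext => y; rewrite mulN1r.
Qed.

Lemma mean_cst c : mean p (fun _ => c) = c.
Proof.
rewrite /mean RintegralZr//; last exact: integrable_density.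
by rewrite /Rintegral; case: dp => _ [_ ->]; rewrite mul1r.
Qed.

Lemma mean_le k k' : bounded_on lo hi k -> bounded_on lo hi k' ->
  (forall y, lo <= y <= hi -> k y <= k' y) -> mean p k <= mean p k'.
Proof.
move=> bk bk' kk'; apply: le_Rintegral => //; try exact: integrable_mean.
move=> y _; have [ylh|ylh] := pselect (lo <= y <= hi); last by rewrite sp// !mul0r.
by rewrite ler_wpM2l// kk'.
Qed.

Lemma mean_ge0 k : bounded_on lo hi k -> (forall y, lo <= y <= hi -> 0 <= k y) ->
  0 <= mean p k.
Proof.
by move=> bk k0; rewrite -[leLHS](mean_cst 0); apply: mean_le => //; exact: bounded_on_cst.
Qed.

Lemma mean_gt0 k : continuous k -> (forall y, 0 < k y) -> 0 < mean p k.
Proof.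
move=> ck k0.
have [c _ cm] := EVT_min lohi (continuous_subspaceT (A := `[lo, hi]) ck).
apply: (lt_le_trans (k0 c)); rewrite -[leLHS](mean_cst (k c)); apply: mean_le.
- exact: bounded_on_cst.
- exact: bounded_on_continuous.
- by move=> y ylh; apply: cm; rewrite in_itv.
Qed.

(** The endpoints are null. The open interval is the useful form because [beta_bounded] compares the
    densities on open intervals only. *)
Lemma mean_itv k : bounded_on lo hi k ->
  mean p k = Rintegral mu `]lo, hi[ (fun y => p y * k y).
Proof.
move=> bk.
have ik (A : set R) : measurable A -> mu.-integrable A (EFin \o (fun y => p y * k y)).
  by move=> mA; apply: (integrableS measurableT) => //; exact: integrable_mean.
rewrite Rintegral_itv_bndo_bndc ?ik// Rintegral_itv_obnd_cbnd ?ik//.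
rewrite [RHS]Rintegral_mkcond; congr fine; apply: eq_integral => y _.
rewrite patchE; case: ifPn => // /negP ylh; rewrite sp ?mul0r//.
by move=> h; apply: ylh; rewrite inE/= in_itv.
Qed.

Lemma integrable_bounded_on k : bounded_on lo hi k ->
  mu.-integrable `]lo, hi[ (EFin \o k).
Proof.
move=> [mk [M kM]]; apply: measurable_bounded_integrable => //.
- by rewrite /= lebesgue_measure_itv/=; case: ifP => //; rewrite -EFinD ltry.
- exact: measurable_funTS.
- exists M; split; first exact: num_real.
  move=> N MN y /=; rewrite in_itv/= => /andP[/ltW y1 /ltW y2].
  by rewrite (le_trans _ (ltW MN))// kM// y1.
Qed.

Lemma le_mean_itv C k : (forall x, lo < x < hi -> p x <= C) ->
  bounded_on lo hi k -> (forall y, 0 <= k y) ->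
  mean p k <= C * Rintegral mu `]lo, hi[ k.
Proof.
move=> pC bk k0; rewrite mean_itv// -RintegralZl//; last exact: integrable_bounded_on.
apply: le_Rintegral => //.
- by apply: (integrableS measurableT) => //; exact: integrable_mean.
- by apply: integrable_bounded_on; exact: bounded_onZ.
- by move=> y /=; rewrite in_itv => /pC ?; rewrite ler_wpM2r.
Qed.

Lemma ge_mean_itv C k : (forall x, lo < x < hi -> C <= p x) ->
  bounded_on lo hi k -> (forall y, 0 <= k y) ->
  C * Rintegral mu `]lo, hi[ k <= mean p k.
Proof.
move=> pC bk k0; rewrite mean_itv// -RintegralZl//; last exact: integrable_bounded_on.
apply: le_Rintegral => //.
- by apply: integrable_bounded_on; exact: bounded_onZ.
- by apply: (integrableS measurableT) => //; exact: integrable_mean.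
- by move=> y /=; rewrite in_itv => /pC ?; rewrite ler_wpM2r.
Qed.

End mean_density.

(** * Differentiation under the expectation *)

Section derivative_of_mean.
Context {R : realType}.
Implicit Types (W Q F f g u v p : R -> R) (x : R).

(** The difference quotient of [W] is at most that of [Q] in absolute value, and the latter tends to
    [0]. *)
Lemma is_derive_squeeze W Q (t : R) : (forall s, `|W s - W t| <= Q s) -> Q t = 0 ->
  is_derive t 1 Q 0 -> is_derive t 1 W 0.
Proof.
move=> WQ Qt dQ.
have cQ : (fun h => h^-1 *: ((Q \o shift t) (h *: 1) - Q t)) h @[h --> 0^'] --> (0 : R).
  have /cvg_ex[/= l cl] : derivable Q t 1 by case: dQ.
  suff e : l = 0 by rewrite e in cl.
  rewrite -(@derive_val _ _ _ _ _ _ _ dQ); apply/esym.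
  by apply: cvg_lim cl; exact: Rhausdorff.
have cW : (fun h => h^-1 *: ((W \o shift t) (h *: 1) - W t)) h @[h --> 0^'] --> (0 : R).
  apply: norm_cvg0; have nQ := cvg_norm cQ; rewrite normr0 in nQ.
  apply: squeeze_cvgr; [|exact: (cvg_cst 0)|exact: nQ].
  near=> h; rewrite normr_ge0/= Qt subr0.
  rewrite /GRing.scale/= !normrM ler_wpM2l//.
  by rewrite (le_trans (WQ _))// ler_norm.
split; first by apply/cvg_ex; exists 0; exact: cW.
by apply: cvg_lim cW; exact: Rhausdorff.
Unshelve. all: by end_near. Qed.

(** Instead of dominated convergence: since [F] has a bounded second derivative and the support is
    bounded, the error of linearising the integrand is quadratic in the increments of [u] and [v],
    uniformly in [y]. *)
Lemma is_derive_mean p F f g u v (lo hi C t du dv : R) :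
  is_density p -> supported_on p lo hi -> lo <= hi ->
  (forall x, is_derive x 1 F (f x)) -> (forall x, is_derive x 1 f (g x)) ->
  (forall x, `|g x| <= C) ->
  is_derive t 1 u du -> is_derive t 1 v dv ->
  is_derive t 1 (fun s => mean p (fun y => F (v s * y - u s)))
    (mean p (fun y => f (v t * y - u t) * (dv * y - du))).
Proof.
move=> dp sp lohi dF df gC du_ dv_.
have cF := is_derive_continuous dF.
have cf := is_derive_continuous df.
have C0 : 0 <= C := le_trans (normr_ge0 _) (gC 0).
have caff (a b : R) : continuous (fun y : R => a * y - b).
  by move=> y; apply: cvgB; [apply: cvgM; [exact: cvg_cst|exact: cvg_id]|exact: cvg_cst].
have ccomp (k : R -> R) (a b : R) : continuous k -> continuous (fun y : R => k (a * y - b)).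
  by move=> ck y; apply: continuous_comp; [exact: caff|exact: ck].
have bd k : continuous k -> bounded_on lo hi k by exact: bounded_on_continuous.
have cfy : continuous (fun y : R => f (v t * y - u t) * y).
  by move=> y; apply: cvgM; [exact: ccomp|exact: cvg_id].
set M := `|lo| + `|hi|.
have yM y : lo <= y <= hi -> `|y| <= M.
  move=> /andP[y1 y2]; rewrite /M ler_norml.
  have := ler_norm hi; have := ler_norm (- lo); rewrite normrN.
  have := normr_ge0 lo; have := normr_ge0 hi; lra.
pose A := mean p (fun y => f (v t * y - u t) * y).
pose B := mean p (fun y => f (v t * y - u t)).
have EAB (a b : R) : mean p (fun y => f (v t * y - u t) * (a * y - b)) = a * A - b * B.
  rewrite /A /B -!(meanZ dp sp) -?(meanB dp sp); try exact: bd.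
  - by congr mean; apply/funext => y; ring.
  - exact/bounded_onZ/bd.
  - by apply/bounded_onZ/bd; exact: ccomp.
  - by apply: bd; exact: ccomp.
rewrite EAB.
pose H s := mean p (fun y => F (v s * y - u s)).
(* Up to a constant, [L] is [H] with the integrand linearised at [t]; [Q] bounds the Taylor
   remainder uniformly over the support. *)
pose L s := v s * A - u s * B.
pose Q s := C * (2 * M ^+ 2 * (v s - v t) ^+ 2 + 2 * (u s - u t) ^+ 2).
have dL : is_derive t 1 L (dv * A - du * B).
  by apply: is_derive_eq; rewrite /GRing.scale/=; ring.
have dQ : is_derive t 1 Q 0.
  by apply: is_derive_eq; rewrite /GRing.scale/=; ring.
have dW : is_derive t 1 (fun s => H s - L s) 0.
  apply: (@is_derive_squeeze _ Q) => //; last by rewrite /Q; ring.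
  move=> s.
  have -> : H s - L s - (H t - L t) = mean p (fun y => F (v s * y - u s)
      - F (v t * y - u t) - f (v t * y - u t) * ((v s - v t) * y - (u s - u t))).
    rewrite (meanB dp sp); first rewrite (meanB dp sp) ?EAB /H /L.
    - by ring.
    - by apply: bd; exact: ccomp.
    - by apply: bd; exact: ccomp.
    - by apply: bd => y; apply: cvgB; exact: ccomp.
    - by apply: bd => y; apply: cvgM; [exact: ccomp|exact: caff].
  have ck : continuous (fun y : R => F (v s * y - u s)
      - F (v t * y - u t) - f (v t * y - u t) * ((v s - v t) * y - (u s - u t))).
    move=> y; apply: cvgB; first by apply: cvgB; exact: ccomp.
    by apply: cvgM; [exact: ccomp|exact: caff].
  have kQ y : lo <= y <= hi -> `|F (v s * y - u s)
      - F (v t * y - u t) - f (v t * y - u t) * ((v s - v t) * y - (u s - u t))| <= Q s.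
    move=> /yM yM'.
    have -> : (v s - v t) * y - (u s - u t) = (v s * y - u s) - (v t * y - u t) by ring.
    apply: le_trans (taylor2_bound dF df gC _ _) _.
    rewrite ler_wpM2l//.
    have y2 : y ^+ 2 <= M ^+ 2.
      by rewrite -(real_normK (num_real y)) ler_pXn2r ?nnegrE// (le_trans _ yM').
    (* [(c - d)^2 <= 2 c^2 + 2 d^2], from [(c + d)^2 >= 0]. *)
    have := sqr_ge0 ((v s - v t) * y + (u s - u t)).
    have : (v s - v t) ^+ 2 * y ^+ 2 <= (v s - v t) ^+ 2 * M ^+ 2.
      by rewrite ler_wpM2l// sqr_ge0.
    by nra.
  rewrite ler_norml; apply/andP; split.
    rewrite -[leLHS](mean_cst dp); apply: (mean_le dp sp).
    - exact: bounded_on_cst.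
    - exact: bd.
    - by move=> y /kQ; rewrite ler_norml => /andP[].
  rewrite -[leRHS](mean_cst dp); apply: (mean_le dp sp).
  - exact: bd.
  - exact: bounded_on_cst.
  - by move=> y /kQ; rewrite ler_norml => /andP[].
have -> : (fun s => mean p (fun y => F (v s * y - u s))) = (fun s => (H s - L s) + L s).
  by apply/funext => s; rewrite subrK.
by apply: is_derive_eq; rewrite add0r.
Qed.

End derivative_of_mean.

(** * The guided field in the coordinates [u = x / b_t], [v = a_t / b_t] *)

Section noise_schedule.
Context {R : realType} (T : R).
Implicit Types (t : R).

Lemma a_gt0 t : 0 < a_ T t. Proof. exact: expR_gt0. Qed.

Lemma a_lt1 t : t < T -> a_ T t < 1.
Proof. by move=> tT; rewrite expR_lt1 subr_lt0. Qed.

Lemma b_arg_gt0 t : t < T -> 0 < 1 - a_ T t ^+ 2.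
Proof. by move=> /a_lt1 a1; have := a_gt0 t; nra. Qed.

Lemma b_gt0 t : t < T -> 0 < b_ T t.
Proof. by move=> tT; rewrite sqrtr_gt0 b_arg_gt0. Qed.

Lemma b_sqr t : t < T -> b_ T t ^+ 2 = 1 - a_ T t ^+ 2.
Proof. by move=> tT; rewrite sqr_sqrtr// ltW// b_arg_gt0. Qed.

Lemma is_derive_a t : is_derive t 1 (a_ T) (a_ T t).
Proof.
rewrite (_ : a_ T = fun s => expR (s - T)); last exact/funext.
by apply: is_derive_eq; rewrite /GRing.scale/= /a_; ring.
Qed.

Lemma is_derive_b t : t < T -> is_derive t 1 (b_ T) (- a_ T t ^+ 2 / b_ T t).
Proof.
move=> tT; have da := is_derive_a t.
have d1 : is_derive t 1 (fun s => 1 - a_ T s ^+ 2) (- 2 * a_ T t ^+ 2).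
  by apply: is_derive_eq; rewrite /GRing.scale/=; ring.
have := is_derive1_comp (g := fun s => 1 - a_ T s ^+ 2) (is_derive1_sqrt (b_arg_gt0 tT)) d1.
rewrite (_ : _ \o _ = b_ T)// => d; apply: (is_derive_eq d).
rewrite -/(b_ T t); field; rewrite gt_eqF ?b_gt0//.
Qed.

Definition snr t := a_ T t / b_ T t.

Lemma snr_gt0 t : t < T -> 0 < snr t.
Proof. by move=> tT; rewrite divr_gt0 ?a_gt0 ?b_gt0. Qed.

Lemma is_derive_divb (x : R -> R) (dx : R) t : t < T -> is_derive t 1 x dx ->
  is_derive t 1 (fun s => x s / b_ T s) (dx / b_ T t + x t / b_ T t * snr t ^+ 2).
Proof.
move=> tT dxt; have db := is_derive_b tT.
have bn : b_ T t != 0 by rewrite gt_eqF ?b_gt0.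
have dV := is_deriveV bn db.
by apply: is_derive_eq; rewrite /GRing.scale/= /snr; field.
Qed.

(** The relation [a^2 + b^2 = 1] merges the two terms of the quotient rule. The factor
    [snr t / b_ T t ^+ 2] is what converts [d/dv] into [d/dt] from here on. *)
Lemma is_derive_snr t : t < T -> is_derive t 1 snr (snr t / b_ T t ^+ 2).
Proof.
move=> tT; apply: (is_derive_eq (is_derive_divb tT (is_derive_a t))).
have bn : b_ T t != 0 by rewrite gt_eqF ?b_gt0.
have e : a_ T t ^+ 2 = 1 - b_ T t ^+ 2 by rewrite b_sqr//; ring.
by rewrite /snr expr_div_n e; field.
Qed.

End noise_schedule.

Section posterior.
Context {R : realType}.
Implicit Types (q : R -> R) (u v x y lo hi T t : R).

(* Up to a common factor, the mass and first moment of the posterior density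
   of [X_0] given [X_t = b_t u], where [v = a_t / b_t] and [X_0] has density [q]. *)
Definition post_mass q u v := mean q (fun y => gpdf (v * y - u)).
Definition post_moment q u v := mean q (fun y => gpdf (v * y - u) * y).

Lemma continuous_post_kernel u v : continuous (fun y : R => gpdf (v * y - u)).
Proof.
move=> y; apply: (@continuous_comp _ _ _ (fun y => v * y - u) gpdf); last exact: continuous_gpdf.
by apply: cvgB; [apply: cvgM; [exact: cvg_cst|exact: cvg_id]|exact: cvg_cst].
Qed.

Lemma continuous_post_moment u v : continuous (fun y : R => gpdf (v * y - u) * y).
Proof. by move=> y; apply: cvgM; [exact: continuous_post_kernel|exact: cvg_id]. Qed.

Section density.
Context q (lo hi : R) (dq : is_density q) (sq : supported_on q lo hi).
Context (lohi : lo <= hi).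

Lemma post_mass_gt0 u v : 0 < post_mass q u v.
Proof.
apply: (mean_gt0 dq sq lohi); first exact: continuous_post_kernel.
by move=> y; exact: gpdf_gt0.
Qed.

Lemma post_moment_bounds u v :
  lo * post_mass q u v <= post_moment q u v <= hi * post_mass q u v.
Proof.
have bk := bounded_on_continuous lohi (@continuous_post_kernel u v).
have bm := bounded_on_continuous lohi (@continuous_post_moment u v).
rewrite -!(meanZ dq sq)//; apply/andP; split; apply: (mean_le dq sq) => //.
- exact: bounded_onZ.
- by move=> y /andP[y1 y2]; rewrite mulrC ler_wpM2l// gpdf_ge0.
- exact: bounded_onZ.
- by move=> y /andP[y1 y2]; rewrite [leRHS]mulrC ler_wpM2l// gpdf_ge0.
Qed.

Lemma noised_densityE T t x : t < T ->
  noised_density q T t x = (b_ T t)^-1 * post_mass q (x / b_ T t) (snr T t).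
Proof.
move=> tT; have b0 := b_gt0 tT.
rewrite -(meanZ dq sq).
  congr fine; apply: eq_integral => y _.
  rewrite normal_pdf_gpdf//; congr (_ * (_ * gpdf _))%:E.
  by rewrite /snr; field; rewrite gt_eqF.
exact: (bounded_on_continuous lohi (@continuous_post_kernel _ _)).
Qed.

Lemma noised_density_gt0 T t x : t < T -> 0 < noised_density q T t x.
Proof.
by move=> tT; rewrite noised_densityE// mulr_gt0 ?invr_gt0 ?b_gt0 ?post_mass_gt0.
Qed.

Lemma is_derive_noised_density T t x : t < T ->
  is_derive x 1 (noised_density q T t)
    (b_ T t ^- 2 * (snr T t * post_moment q (x / b_ T t) (snr T t)
                    - x / b_ T t * post_mass q (x / b_ T t) (snr T t))).
Proof.
move=> tT; have bn : b_ T t != 0 by rewrite gt_eqF ?b_gt0.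
set b := b_ T t in bn *; set v := snr T t.
have -> : noised_density q T t =
    (fun y => b^-1 * mean q (fun z => gpdf ((fun _ => v) y * z - (fun s => s / b) y))).
  by apply/funext => y; rewrite noised_densityE.
have d0 : is_derive x 1 (fun _ : R => v) 0 by exact: is_derive_cst.
have d1 : is_derive x 1 (fun s : R => s / b) b^-1.
  by apply: is_derive_eq; rewrite /GRing.scale/=; ring.
have dm := is_derive_mean dq sq lohi (@is_derive_gpdf R) (@is_derive_gpdf2 R)
  (@gpdf2_bound R) d1 d0.
apply: is_derive_eq.
rewrite /GRing.scale/= expr2 invfM -[RHS]mulrA; congr (_ * _).
have bk := bounded_on_continuous lohi (@continuous_post_kernel (x / b) v).
have bm := bounded_on_continuous lohi (@continuous_post_moment (x / b) v).
have bk' := bounded_onZ (x / b) bk; have bm' := bounded_onZ v bm.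
rewrite /post_moment /post_mass -!(meanZ dq sq)// -(meanB dq sq)//.
rewrite -(meanZ dq sq); last first.
  by apply: (bounded_on_continuous lohi) => y; apply: cvgB; apply: cvgM;
    [exact: cvg_cst|exact: continuous_post_moment|exact: cvg_cst|exact: continuous_post_kernel].
by congr mean; apply/funext => y; ring.
Qed.

End density.

Lemma scoreE (f : R -> R) (df x : R) : is_derive x 1 f df -> 0 < f x ->
  score f x = df / f x.
Proof.
move=> dfx f0; rewrite /score derive1E mulrC.
have d := is_derive1_comp (is_derive1_ln f0) dfx.
exact: (@derive_val _ _ _ _ _ _ _ d).
Qed.

End posterior.

Section guided.
Context {R : realType} (p1 pm1 : R -> R) (a1 a2 T w : R).
Context (dp1 : is_density p1) (dpm1 : is_density pm1).
Context (sp1 : supported_on p1 a1 a2) (spm1 : supported_on pm1 (- a2) (- a1)).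
Context (a12 : a1 <= a2).
Implicit Types (t x u v : R).

(** The posterior mean of [X_0] for class [1] minus the one for the mixture, where the weights [1/2]
    cancel. *)
Definition guidance u v := post_moment p1 u v / post_mass p1 u v
  - (post_moment p1 u v + post_moment pm1 u v) / (post_mass p1 u v + post_mass pm1 u v).

Let a12N : - a2 <= - a1. Proof. by rewrite lerN2. Qed.

(** By Tweedie's formula each score equals [(v m - u) / b], with [m] the corresponding posterior
    mean. The terms in [u] then add up to [u (1 + v^2 - 1 / b^2) = 0]. *)
Lemma guided_fieldE t x : t < T ->
  let u := x / b_ T t in let v := snr T t in
  guided_field p1 pm1 T w t x / b_ T t + u * v ^+ 2 =
  v / b_ T t ^+ 2 * (post_moment p1 u v / post_mass p1 u v + w * guidance u v).
Proof.
move=> tT u v; have bn : b_ T t != 0 by rewrite gt_eqF ?b_gt0.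
have d1 := is_derive_noised_density dp1 sp1 a12 x tT.
have dm := is_derive_noised_density dpm1 spm1 a12N x tT.
have f1 := noised_density_gt0 dp1 sp1 a12 x tT.
have fm := noised_density_gt0 dpm1 spm1 a12N x tT.
rewrite /guided_field (scoreE d1 f1).
have dx : is_derive x 1 (mixture_noised_density p1 pm1 T t) (2^-1 *
   (b_ T t ^- 2 * (v * post_moment p1 u v - u * post_mass p1 u v)) + 2^-1 *
   (b_ T t ^- 2 * (v * post_moment pm1 u v - u * post_mass pm1 u v))).
  rewrite /mixture_noised_density.
  by apply: is_derive_eq; rewrite /GRing.scale.
rewrite (scoreE dx) ?addr_gt0 ?mulr_gt0//.
rewrite /mixture_noised_density (noised_densityE dp1 sp1)// (noised_densityE dpm1 spm1)//.
rewrite -/u -/v /guidance.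
have N1 := post_mass_gt0 dp1 sp1 a12 u v.
have Nm := post_mass_gt0 dpm1 spm1 a12N u v.
have bs : v ^+ 2 = b_ T t ^- 2 - 1.
  rewrite /v /snr expr_div_n; have := b_sqr tT; set b := b_ T t in bn *.
  move=> e; have -> : a_ T t ^+ 2 = 1 - b ^+ 2 by rewrite e; ring.
  by field.
rewrite bs.
have ux : x = u * b_ T t by rewrite /u; field.
rewrite [X in (X + _ - _) / _]ux.
move: N1 Nm bn; set N := post_mass p1 u v; set N' := post_mass pm1 u v; set b := b_ T t.
set M := post_moment p1 u v; set M' := post_moment pm1 u v.
move=> N1 Nm bn; field.
by rewrite bn !gt_eqF// ?addr_gt0// mulr_gt0.
Qed.

Lemma is_derive_rescaled (x : R -> R) t : t < T ->
  is_derive t 1 x (guided_field p1 pm1 T w t (x t)) ->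
  let u := x t / b_ T t in let v := snr T t in
  is_derive t 1 (fun s => x s / b_ T s)
    (v / b_ T t ^+ 2 * (post_moment p1 u v / post_mass p1 u v + w * guidance u v)).
Proof.
move=> tT dx u v; apply: (is_derive_eq (is_derive_divb tT dx)).
exact: guided_fieldE.
Qed.

(** The guidance is [c] times the difference of the posterior means of the two classes, which lie in
    [[a1, a2]] and [[- a2, - a1]]. *)
Lemma guidance_bounds u v (c := post_mass pm1 u v / (post_mass p1 u v + post_mass pm1 u v)) :
  2 * a1 * c <= guidance u v <= 2 * a2 * c.
Proof.
have N1 := post_mass_gt0 dp1 sp1 a12 u v.
have Nm := post_mass_gt0 dpm1 spm1 a12N u v.
have /andP[] := post_moment_bounds dp1 sp1 a12 u v.
have /andP[] := post_moment_bounds dpm1 spm1 a12N u v.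
rewrite /c /guidance {c}; move: N1 Nm.
set N := post_mass p1 u v; set N' := post_mass pm1 u v.
set M := post_moment p1 u v; set M' := post_moment pm1 u v => N1 Nm.
move=> l1 r1 l2 r2.
have m1 : a1 <= M / N by rewrite ler_pdivlMr.
have m2 : M / N <= a2 by rewrite ler_pdivrMr.
have m3 : - a2 <= M' / N' by rewrite ler_pdivlMr.
have m4 : M' / N' <= - a1 by rewrite ler_pdivrMr.
have -> : M / N - (M + M') / (N + N') = (M / N - M' / N') * (N' / (N + N')).
  by field; rewrite !gt_eqF// addr_gt0.
have c0 : 0 <= N' / (N + N') by rewrite divr_ge0 ?addr_ge0// ltW.
by rewrite !ler_wpM2r//; lra.
Qed.

End guided.

(** * Consequences of [beta]-boundedness *)

Section comparison.
Context {R : realType} (p1 pm1 : R -> R) (a1 a2 beta : R).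
Context (a12 : a1 < a2) (beta1 : 1 <= beta).
Context (dp1 : is_density p1) (dpm1 : is_density pm1).
Context (sp1 : supported_on p1 a1 a2) (spm1 : supported_on pm1 (- a2) (- a1)).
Context (bb : beta_bounded pm1 p1 a1 a2 beta).
Implicit Types (x y u v m r : R).
Notation mu := (@lebesgue_measure R).

Let a12W : a1 <= a2. Proof. exact: ltW. Qed.
Let a12N : - a2 <= - a1. Proof. by rewrite lerN2. Qed.
Let beta0 : 0 < beta. Proof. by apply: lt_le_trans beta1. Qed.
Let L0 : 0 < a2 - a1. Proof. by rewrite subr_gt0. Qed.

(* [beta_bounded] forces [p1] to be positive, because [x / 0 = 0]. *)
Lemma beta_bounded_le x1 x2 : - a2 < x1 < - a1 -> a1 < x2 < a2 ->
  pm1 x1 <= beta * p1 x2 /\ p1 x2 <= beta * pm1 x1.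
Proof.
move=> h1 h2; have /andP[l r] := bb h1 h2.
have p0 : 0 < p1 x2.
  rewrite lt_neqAle; case: dp1 => _ [-> _]; rewrite andbT eq_sym.
  apply/eqP => e; move: l; rewrite e invr0 mulr0 leNgt invr_gt0.
  by rewrite beta0.
by move: l r; rewrite ler_pdivlMr// ler_pdivrMr// ler_pdivrMl.
Qed.

Lemma Rintegral_itv_oo1 (lo hi : R) : lo < hi ->
  Rintegral mu `]lo, hi[ (fun _ => 1) = hi - lo.
Proof.
by move=> lh; rewrite Rintegral_cst//= lebesgue_measure_itv/= lte_fin lh mul1r -EFinB.
Qed.

(** Integrate [pm1 y <= beta * p1 x] over [y]: the left side has mass [1] and the interval has
    length [a2 - a1]. *)
Lemma density1_lb x : a1 < x < a2 -> (beta * (a2 - a1))^-1 <= p1 x.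
Proof.
move=> xa; have h y : - a2 < y < - a1 -> pm1 y <= beta * p1 x.
  by move=> ya; case: (beta_bounded_le ya xa).
have := le_mean_itv dpm1 spm1 h (bounded_on_cst _ _ 1) (fun=> ler01).
rewrite (mean_cst dpm1) Rintegral_itv_oo1 ?ltrN2// opprK addrC => H.
by rewrite -[leLHS]mul1r ler_pdivrMr ?mulr_gt0//; lra.
Qed.

Lemma density1_ub x : a1 < x < a2 -> p1 x <= beta / (a2 - a1).
Proof.
move=> xa; have h y : - a2 < y < - a1 -> beta^-1 * p1 x <= pm1 y.
  by move=> ya; rewrite ler_pdivrMl//; case: (beta_bounded_le ya xa).
have := ge_mean_itv dpm1 spm1 h (bounded_on_cst _ _ 1) (fun=> ler01).
rewrite (mean_cst dpm1) Rintegral_itv_oo1 ?ltrN2// opprK addrC.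
by rewrite -mulrA ler_pdivrMl// mulr1 ler_pdivlMr.
Qed.

(** Up to a constant factor, the posterior mass for [X_0] uniform on []a1, a2[]; both classes are
    compared with this reference. *)
Definition itv_mass u v := Rintegral mu `]a1, a2[ (fun y => gpdf (v * y - u)).

Lemma itv_mass_reflect u v :
  Rintegral mu `]- a2, - a1[ (fun y => gpdf (v * y - u)) = itv_mass (- u) v.
Proof.
have ik (lo hi : R) : lo <= hi -> mu.-integrable `]lo, hi[ (EFin \o (fun y => gpdf (v * y - u))).
  move=> lh; apply: integrable_bounded_on; apply: (bounded_on_continuous lh).
  exact: continuous_post_kernel.
have ik' (lo hi : R) : lo <= hi -> mu.-integrable `]lo, hi[ (EFin \o (fun y => gpdf (v * y - - u))).
  move=> lh; apply: integrable_bounded_on; apply: (bounded_on_continuous lh).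
  exact: continuous_post_kernel.
have ic (lo hi : R) (k : R -> R) : continuous k -> mu.-integrable `[lo, hi[ (EFin \o k).
  move=> ck; apply: (@integrableS _ _ _ mu `[lo, hi]) => //.
    by apply: subset_itvl; rewrite bnd_simp.
  apply: continuous_compact_integrable; first exact: segment_compact.
  exact: continuous_subspaceT.
rewrite /itv_mass !Rintegral_itv_obnd_cbnd ?ik ?ik'//.
rewrite !Rintegral_itv_bndo_bndc; try by apply: ic; exact: continuous_post_kernel.
rewrite /Rintegral integration_by_substitution_oppr//; last first.
  exact/continuous_subspaceT/continuous_post_kernel.
congr fine; apply: eq_integral => y _ /=; rewrite -gpdfN; congr (gpdf _)%:E.
by ring.
Qed.

Lemma itv_mass_gt0 u v : 0 < itv_mass u v.
Proof.
have bk := bounded_on_continuous a12W (@continuous_post_kernel _ u v).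
have := le_mean_itv dp1 sp1 density1_ub bk (fun=> gpdf_ge0 _).
move=> /(lt_le_trans (post_mass_gt0 dp1 sp1 a12W u v)).
by rewrite pmulr_rgt0// divr_gt0.
Qed.

Lemma le_itv_mass u v u' v' c : (forall y, a1 < y < a2 ->
    gpdf (v * y - u) <= c * gpdf (v' * y - u')) -> itv_mass u v <= c * itv_mass u' v'.
Proof.
move=> h.
have bk u0 v0 := bounded_on_continuous a12W (@continuous_post_kernel R u0 v0).
rewrite -RintegralZl//; last exact: integrable_bounded_on.
apply: le_Rintegral => //.
- exact: integrable_bounded_on.
- by apply: integrable_bounded_on; exact: bounded_onZ.
Qed.

(** For fixed [x], integrating [p1 x <= beta * pm1 y] against the kernel in [y] bounds [p1 x]; the
    kernel is then integrated in [x]. Bounding the two densities separately by constants would cost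
    [beta^2] instead of [beta]. *)
Lemma post_mass_cross1 u v :
  post_mass p1 u v * itv_mass (- u) v <= beta * post_mass pm1 u v * itv_mass u v.
Proof.
have bk lo hi (lh : lo <= hi) := bounded_on_continuous lh (@continuous_post_kernel R u v).
rewrite mulrC -ler_pdivlMl ?itv_mass_gt0// mulrA.
apply: (le_mean_itv dp1 sp1) => // [x xa||]; [|exact: bk|by move=> y; exact: gpdf_ge0].
rewrite ler_pdivlMl ?itv_mass_gt0// -ler_pdivrMl// mulrCA mulrC.
rewrite -itv_mass_reflect; apply: (ge_mean_itv dpm1 spm1) => //.
- by move=> y ya; rewrite ler_pdivrMl//; case: (beta_bounded_le ya xa).
- exact: bk.
- by move=> y; exact: gpdf_ge0.
Qed.

Lemma post_mass_cross2 u v :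
  post_mass pm1 u v * itv_mass u v <= beta * post_mass p1 u v * itv_mass (- u) v.
Proof.
have bk lo hi (lh : lo <= hi) := bounded_on_continuous lh (@continuous_post_kernel R u v).
rewrite mulrC -ler_pdivlMl ?itv_mass_gt0// mulrA -itv_mass_reflect.
apply: (le_mean_itv dpm1 spm1) => // [x xa||]; last by move=> y; exact: gpdf_ge0.
  rewrite ler_pdivlMl ?itv_mass_gt0// mulrC -ler_pdivrMl// mulrA.
  apply: (ge_mean_itv dp1 sp1) => //.
  - by move=> y ya; rewrite ler_pdivrMl//; case: (beta_bounded_le xa ya).
  - exact: bk.
  - by move=> y; exact: gpdf_ge0.
exact: bk.
Qed.

(** The exponents differ through [(v y + u)^2 - (v y - u)^2 = 4 u v y]. *)
Lemma gpdf_tilt z y u v : z = expR (- (2 * (u * v) * y)) ->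
  gpdf (v * y - - u) = z * gpdf (v * y - u).
Proof.
move=> ->; rewrite !gpdfE mulrCA -expRD; congr (_ * expR _).
by field.
Qed.

Lemma post_mass_lb u v m : 0 <= a1 -> 0 <= m -> u * v <= m ->
  expR (- (2 * a2 * m)) * post_mass p1 u v <= beta * post_mass pm1 u v.
Proof.
move=> a10 m0 uvm.
have I0 := itv_mass_gt0 u v.
rewrite -(ler_pM2r I0); apply: le_trans (post_mass_cross1 u v).
rewrite -[leLHS]mulrA [leLHS]mulrCA ler_wpM2l ?(ltW (post_mass_gt0 dp1 sp1 a12W _ _))//.
rewrite -ler_pdivlMl ?expR_gt0// -expRN; apply: le_itv_mass => y /andP[y1 y2].
rewrite (gpdf_tilt erefl) mulrA -expRD ler_peMl ?gpdf_ge0//.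
rewrite -[leLHS]expR0 ler_expR.
(* Going through [m * y], where [0 <= m], also covers negative [u * v]. *)
have : u * v * y <= m * a2 by
  apply: le_trans (_ : m * y <= _); [rewrite ler_wpM2r//|rewrite ler_wpM2l//]; lra.
by lra.
Qed.

Lemma post_mass_ub u v m : 0 <= a1 -> 0 <= m -> m <= u * v ->
  post_mass pm1 u v <= beta * expR (- (2 * a1 * m)) * post_mass p1 u v.
Proof.
move=> a10 m0 uvm.
have I0 := itv_mass_gt0 u v.
rewrite -(ler_pM2r I0); apply: (le_trans (post_mass_cross2 u v)).
rewrite -!mulrA ler_wpM2l ?(ltW beta0)// mulrCA ler_wpM2l ?(ltW (post_mass_gt0 dp1 sp1 a12W _ _))//.
apply: le_itv_mass => y /andP[y1 y2].
rewrite (gpdf_tilt erefl) ler_wpM2r ?gpdf_ge0// ler_expR.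
have : m * a1 <= u * v * y by
  apply: le_trans (_ : m * y <= _); [rewrite ler_wpM2l//|rewrite ler_wpM2r//]; lra.
by lra.
Qed.

(** [P(X_0 > r)] under [p1], written as a mean so that [mean_le] can compare it with means of
    [gcdf]. *)
Definition tail_mass r := mean p1 \1_(`]r, +oo[%classic : set R).

Let bi r : bounded_on a1 a2 (\1_(`]r, +oo[%classic : set R) : R -> R).
Proof. exact: bounded_on_indic. Qed.

Lemma indic_ray r y : (\1_(`]r, +oo[%classic : set R) y : R) = (r < y)%R%:R.
Proof. by rewrite indicE mem_setE in_itv/= andbT. Qed.

Lemma tail_mass_le1 r : tail_mass r <= 1.
Proof.
rewrite -[leRHS](mean_cst dp1); apply: (mean_le dp1 sp1); [exact: bi|exact: bounded_on_cst|].
by move=> y _; rewrite indic_ray; case: (r < y).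
Qed.

Lemma tail_mass_below r : r < a1 -> tail_mass r = 1.
Proof.
move=> ra; apply/eqP; rewrite eq_le tail_mass_le1/=.
rewrite -[leLHS](mean_cst dp1); apply: (mean_le dp1 sp1); [exact: bounded_on_cst|exact: bi|].
by move=> y /andP[ay _]; rewrite indic_ray (lt_le_trans ra).
Qed.

Lemma tail_mass_above r : a2 <= r -> tail_mass r <= 0.
Proof.
move=> ra; rewrite -[leRHS](mean_cst dp1); apply: (mean_le dp1 sp1); [exact: bi|exact: bounded_on_cst|].
by move=> y /andP[_ ya]; rewrite indic_ray ltNge (le_trans ya).
Qed.

Lemma tail_mass_decr r r' : r <= r' -> tail_mass r' <= tail_mass r.
Proof.
move=> rr; apply: (mean_le dp1 sp1); [exact: bi|exact: bi|] => y _; rewrite !indic_ray ler_nat.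
by case: (ltP r' y) => // /(le_lt_trans rr) ->.
Qed.

Lemma Rintegral_indic_itv (i j : interval R) (c d : R) : c < d ->
  [set` j] `&` [set` i] = `]c, d[%classic ->
  Rintegral mu [set` i] \1_[set` j] = d - c.
Proof.
move=> cd e; rewrite /Rintegral integral_indic//= e lebesgue_measure_itv/=.
by rewrite lte_fin cd.
Qed.

(** Quantitative strict monotonicity, from [density1_lb] on []r, r'[]. It identifies the limit, and
    with [r' = a2] it yields the lower bound on the limit. *)
Lemma tail_mass_gap r r' : a1 <= r -> r < r' -> r' <= a2 ->
  tail_mass r' + (r' - r) / (beta * (a2 - a1)) <= tail_mass r.
Proof.
move=> ar rr' ra.
have bj : bounded_on a1 a2 (\1_(`]r, r'[%classic : set R) : R -> R).
  exact: bounded_on_indic.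
apply: (@le_trans _ _ (tail_mass r' + mean p1 \1_(`]r, r'[%classic : set R))).
  rewrite lerD2l; apply: le_trans (ge_mean_itv dp1 sp1 density1_lb bj _); last first.
    by move=> y; rewrite indicE; case: (_ \in _).
  rewrite (@Rintegral_indic_itv _ _ r r')//; first by rewrite mulrC.
  apply/seteqP; split => y /=; rewrite !in_itv/=; first by case.
  by move=> /andP[y1 y2]; split; [rewrite y1|apply/andP; split; lra].
rewrite -(meanD dp1 sp1)//; apply: (mean_le dp1 sp1); [exact: bounded_onD|exact: bi|].
move=> y _; rewrite !indic_ray indicE mem_setE in_itv/=.
case: (ltP r' y) => [ry|_].
  by rewrite (lt_trans rr' ry) [y < r']ltNge (ltW ry)/= addr0.
by rewrite add0r ler_nat; case: (r < y); case: (y < r').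
Qed.

Lemma tail_mass_ub r : a1 <= r -> r < a2 ->
  tail_mass r <= beta / (a2 - a1) * (a2 - r).
Proof.
move=> ar ra; apply: (le_trans (le_mean_itv dp1 sp1 density1_ub (bi r) _)).
  by move=> y; rewrite indicE; case: (_ \in _).
rewrite (@Rintegral_indic_itv _ _ r a2)//.
apply/seteqP; split => y /=; rewrite !in_itv/= ?andbT; first by case=> -> /andP[_ ->].
by move=> /andP[y1 y2]; split=> //; rewrite y2 (le_lt_trans ar).
Qed.

End comparison.

(** * The exceedance probability along a trajectory *)

Lemma snr_large {R : realType} (T K : R) : 0 < T -> 1 <= K ->
  exists2 t2, 0 < t2 < T & forall t, t2 <= t < T -> K <= snr T t.
Proof.
move=> T0 K1; have K0 : 0 < K by lra.
have k0 : 0 < (8 * K ^+ 2)^-1 by rewrite invr_gt0 mulr_gt0// exprn_gt0.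
have kK : (8 * K ^+ 2)^-1 * K ^+ 2 = 8^-1 by field; rewrite gt_eqF.
(* If [T - t <= 1 / (8 K^2)], then [b^2 <= 2 (1 - a) <= 1 / (4 K^2)], so [K b <= 1/2], while
   [a >= 7/8]. The maximum with [T / 2] keeps the time positive. *)
exists (Num.max (T / 2) (T - (8 * K ^+ 2)^-1)).
  by rewrite lt_max gt_max; apply/andP; split; [apply/orP; left|apply/andP; split]; lra.
move=> t /andP[]; rewrite ge_max => /andP[_ t2] tT.
have b0 := b_gt0 tT; have a0 := a_gt0 T t; have a1 := a_lt1 tT.
have ha : 1 + (t - T) <= a_ T t by exact: expR_ge1Dx.
have hb : b_ T t ^+ 2 <= 2 * (8 * K ^+ 2)^-1 by rewrite b_sqr//; nra.
have k8 : (8 * K ^+ 2)^-1 <= 8^-1 by rewrite -kK ler_peMr ?(ltW k0)//; nra.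
rewrite /snr ler_pdivlMr//.
have : (K * b_ T t) ^+ 2 <= (2^-1) ^+ 2.
  rewrite exprMn; apply: (@le_trans _ _ (K ^+ 2 * (2 * (8 * K ^+ 2)^-1))).
    by rewrite ler_wpM2l// sqr_ge0.
  by rewrite mulrCA [K ^+ 2 * _]mulrC kK; lra.
rewrite ler_pXn2r ?nnegrE ?mulr_ge0 ?(ltW K0) ?(ltW b0) ?invr_ge0// => h.
by lra.
Qed.

Section trajectory.
Context {R : realType} (p1 pm1 : R -> R) (a1 a2 beta T w : R) (x : R -> R).
Context (a10 : 0 < a1) (a12 : a1 < a2) (beta1 : 1 <= beta) (T0 : 0 < T) (w0 : 0 < w).
Context (dp1 : is_density p1) (dpm1 : is_density pm1).
Context (sp1 : supported_on p1 a1 a2) (spm1 : supported_on pm1 (- a2) (- a1)).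
Context (bb : beta_bounded pm1 p1 a1 a2 beta).
Context (cx : {within `[0, T[, continuous x}).
Context (dx : forall t : R, 0 < t < T -> is_derive t 1 x (guided_field p1 pm1 T w t (x t))).
Implicit Types (s t y K : R).

Let a12W : a1 <= a2. Proof. exact: ltW. Qed.
Let a12N : - a2 <= - a1. Proof. by rewrite lerN2. Qed.
Let beta0 : 0 < beta. Proof. by apply: lt_le_trans beta1. Qed.
Let a20 : 0 < a2. Proof. exact: lt_trans a12. Qed.

Local Notation v := (snr T).
(* Locked because rewriting modulo unfolding would treat [scaled t] as a product. *)
Definition scaled := locked (fun t => x t / b_ T t).

Lemma scaledE : scaled = (fun t => x t / b_ T t).
Proof. by rewrite /scaled -lock. Qed.

Local Notation u := scaled.
Local Notation N1 t := (post_mass p1 (u t) (v t)).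
Local Notation Nm t := (post_mass pm1 (u t) (v t)).
Local Notation D t := (guidance p1 pm1 (u t) (v t)).

(** This is [du/dv] along the trajectory. *)
Definition speed t := post_moment p1 (u t) (v t) / N1 t + w * D t.

Lemma is_derive_scaled t : 0 < t < T ->
  is_derive t 1 u (v t / b_ T t ^+ 2 * speed t).
Proof.
move=> t0T; have /andP[_ tT] := t0T; rewrite /speed scaledE.
exact: (is_derive_rescaled dp1 dpm1 sp1 spm1 a12W tT (dx t0T)).
Qed.

Lemma snr_rate_gt0 t : t < T -> 0 < v t / b_ T t ^+ 2.
Proof. by move=> tT; rewrite divr_gt0 ?exprn_gt0 ?snr_gt0 ?b_gt0. Qed.

Lemma guidance_ge t : 2 * a1 * (Nm t / (N1 t + Nm t)) <= D t.
Proof. by have /andP[] := guidance_bounds dp1 dpm1 sp1 spm1 a12W (u t) (v t). Qed.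

Lemma guidance_ge0 t : 0 <= D t.
Proof.
apply: le_trans (guidance_ge t); apply: mulr_ge0; first by rewrite mulr_ge0// ltW.
have n1 := ltW (post_mass_gt0 dp1 sp1 a12W (u t) (v t)).
have nm := ltW (post_mass_gt0 dpm1 spm1 a12N (u t) (v t)).
by rewrite divr_ge0 ?addr_ge0.
Qed.

Lemma speed_ge t : a1 + w * D t <= speed t.
Proof.
rewrite /speed lerD2r ler_pdivlMr ?(post_mass_gt0 dp1 sp1)//.
by have /andP[] := post_moment_bounds dp1 sp1 a12W (u t) (v t).
Qed.

Lemma continuous_snr t : t < T -> {for t, continuous v}.
Proof.
move=> tT; apply/differentiable_continuous/derivable1_diffP.
by case: (is_derive_snr tT).
Qed.

Lemma continuous_scaled s t : 0 <= s -> t < T -> {within `[s, t], continuous u}.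
Proof.
move=> s0 tT; have sub : `[s, t] `<=` (`[0, T[%classic : set R).
  by move=> y /=; rewrite !in_itv/= => /andP[sy yt]; rewrite (le_trans s0)//= (le_lt_trans yt).
have cxs := continuous_subspaceW sub cx.
have cV : {within `[s, t], continuous (fun z => (b_ T z)^-1)}.
  apply: continuous_in_subspaceT => z; rewrite inE/= in_itv/= => /andP[_ zt].
  have zT := le_lt_trans zt tT.
  apply: cvgV; first by rewrite gt_eqF ?b_gt0.
  apply/differentiable_continuous/derivable1_diffP; by case: (is_derive_b zT).
by rewrite scaledE => z; apply: cvgM; [exact: cxs|exact: cV].
Qed.

(** The function [u - K v] is nondecreasing, its time derivative being a positive factor times
    [speed - K]. *)
Lemma scaled_growth K s t : 0 <= s -> s <= t -> t < T ->
  (forall r, s < r < t -> K <= speed r) -> u s + K * (v t - v s) <= u t.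
Proof.
move=> s0 st tT hK.
suff : u s - K * v s <= u t - K * v t by lra.
apply: (@is_derive_ge0_le _ (fun r => u r - K * v r)
  (fun r => v r / b_ T r ^+ 2 * (speed r - K))) => //.
- have cv : {within `[s, t], continuous v}.
    apply: continuous_in_subspaceT => z; rewrite inE/= in_itv/= => /andP[_ zt].
    exact/continuous_snr/(le_lt_trans zt).
  move=> z; apply: cvgB; first exact: continuous_scaled.
  by apply: cvgM; [exact: cvg_cst|exact: cv].
- move=> r /andP[sr rt]; have rT := lt_trans rt tT.
  have d1 : is_derive r 1 u (v r / b_ T r ^+ 2 * speed r).
    by apply: is_derive_scaled; rewrite rT (le_lt_trans s0).
  have d2 := is_derive_snr rT.
  by apply: is_derive_eq; rewrite /GRing.scale/=; ring.
- move=> r /[dup] /hK h /andP[_ rt].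
  by rewrite mulr_ge0 ?subr_ge0// ltW// snr_rate_gt0// (lt_trans rt).
Qed.

Lemma scaled_growth_a1 s t : 0 <= s -> s <= t -> t < T ->
  u s + a1 * (v t - v s) <= u t.
Proof.
move=> s0 st tT; apply: scaled_growth => // r _.
by apply: le_trans (speed_ge r); rewrite lerDl mulr_ge0 ?guidance_ge0// ltW.
Qed.

Lemma snr_le s t : s <= t -> t < T -> v s <= v t.
Proof.
move=> st tT; apply: (@is_derive_ge0_le _ v (fun r => v r / b_ T r ^+ 2)) => //.
- apply: continuous_in_subspaceT => z; rewrite inE/= in_itv/= => /andP[_ zt].
  exact/continuous_snr/(le_lt_trans zt).
- by move=> r /andP[_ rt]; apply: is_derive_snr; exact: lt_trans tT.
- by move=> r /andP[_ rt]; rewrite ltW// snr_rate_gt0// (lt_trans rt).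
Qed.

Lemma scaled_le s t : 0 <= s -> s <= t -> t < T -> u s <= u t.
Proof.
move=> s0 st tT; apply: le_trans (scaled_growth_a1 s0 st tT).
by rewrite lerDl mulr_ge0 ?(ltW a10)// subr_ge0 snr_le.
Qed.

(* [P(v_t X_0 + Z > u_t)] for [X_0] of density [p1] and [Z] standard normal.
   The unguided flow transports the laws of [v_t X_0 + Z], so it preserves this
   probability; guidance pushes [u] upwards and can only decrease it. *)
Definition exceedance t := mean p1 (fun y => gcdf (v t * y - u t)).
Local Notation S := exceedance.

Lemma continuous_exceedance_kernel c d : continuous (fun y : R => gcdf (c * y - d)).
Proof.
move=> y; apply: (@continuous_comp _ _ _ (fun y => c * y - d) gcdf); last exact: continuous_gcdf.
by apply: cvgB; [apply: cvgM; [exact: cvg_cst|exact: cvg_id]|exact: cvg_cst].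
Qed.

Let bg c d := bounded_on_continuous a12W (@continuous_exceedance_kernel c d).

(** In the variable [v] the derivative is [M - (m1 + w D) N1], where [M] is the posterior moment.
    Since [M = m1 N1], the unguided part cancels. *)
Lemma is_derive_exceedance t : 0 < t < T ->
  is_derive t 1 S (- (v t / b_ T t ^+ 2 * (w * D t * N1 t))).
Proof.
move=> t0T; have /andP[_ tT] := t0T.
apply: (is_derive_eq (is_derive_mean dp1 sp1 a12W (@is_derive_gcdf R) (@is_derive_gpdf R)
  (@gpdf_lin_bound R) (is_derive_scaled t0T) (is_derive_snr tT))).
have bk := bounded_on_continuous a12W (@continuous_post_kernel R (u t) (v t)).
have bm := bounded_on_continuous a12W (@continuous_post_moment R (u t) (v t)).
set V := v t / b_ T t ^+ 2.
transitivity (V * post_moment p1 (u t) (v t) - V * speed t * N1 t).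
  rewrite /post_moment /post_mass -!(meanZ dp1 sp1)// -(meanB dp1 sp1); try exact: bounded_onZ.
  by congr mean; apply/funext => y; ring.
rewrite /speed; have := post_mass_gt0 dp1 sp1 a12W (u t) (v t).
by move=> n0; field; rewrite gt_eqF.
Qed.

Lemma exceedance_decr s t : 0 < s -> s <= t -> t < T -> S t <= S s.
Proof.
move=> s0 st tT; rewrite -lerN2.
apply: (@is_derive_ge0_le _ (fun r => - S r)
  (fun r => v r / b_ T r ^+ 2 * (w * D r * N1 r))) => //.
- apply: continuous_in_subspaceT => z; rewrite inE/= in_itv/= => /andP[sz zt].
  apply: cvgN; apply/differentiable_continuous/derivable1_diffP.
  by case: (@is_derive_exceedance z _) => //; rewrite (lt_le_trans s0)// (le_lt_trans zt).
- move=> r /andP[sr rt].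
  have d1 : is_derive r 1 S (- (v r / b_ T r ^+ 2 * (w * D r * N1 r))).
    by apply: is_derive_exceedance; rewrite (lt_trans s0)// (lt_trans rt).
  by apply: is_derive_eq; rewrite opprK.
- move=> r /andP[sr rt].
  rewrite mulr_ge0 ?(ltW (snr_rate_gt0 _)) ?(lt_trans rt)//.
  by rewrite !mulr_ge0 ?guidance_ge0 ?(ltW w0) ?(ltW (post_mass_gt0 dp1 sp1 a12W _ _)).
Qed.

Lemma exceedance_gt0 t : 0 < S t.
Proof.
apply: (mean_gt0 dp1 sp1 a12W); first exact: continuous_exceedance_kernel.
by move=> y; apply: (le_lt_trans (gcdf_ge0 (v t * y - u t - 1))); rewrite gcdf_lt// gtrBl.
Qed.

Lemma exceedance_le t : t < T -> S t <= gcdf (v t * a2 - u t).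
Proof.
move=> tT; rewrite -[leRHS](mean_cst dp1); apply: (mean_le dp1 sp1).
- exact: bg.
- exact: bounded_on_cst.
- by move=> y /andP[_ ya]; rewrite gcdf_le// lerD2r ler_wpM2l// ltW// snr_gt0.
Qed.

Lemma exceedance_lt1 t : t < T -> S t < 1.
Proof. by move=> tT; apply: le_lt_trans (exceedance_le tT) (gcdf_lt1 _). Qed.

(** Averages the pointwise bound [gpdf_le_gcdf]. It makes the loss rate of the exceedance
    proportional to the exceedance itself, ready for a Gronwall argument. *)
Lemma post_mass_le_exceedance t : t < T -> 0 <= u t ->
  N1 t <= expR (3 / 2) * (1 + a2 * v t + u t) * S t.
Proof.
move=> tT u0; rewrite -(meanZ dp1 sp1)//; apply: (mean_le dp1 sp1).
- exact/(bounded_on_continuous a12W)/continuous_post_kernel.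
- exact: bounded_onZ.
- move=> y /andP[ay ya]; apply: (le_trans (gpdf_le_gcdf _)).
  rewrite ler_wpM2r ?gcdf_ge0// ler_wpM2l ?expR_ge0//.
  rewrite -addrA lerD2l (le_trans (ler_normB _ _))// (ger0_norm u0) lerD2r.
  have vt := snr_gt0 tT.
  by rewrite normrM (gtr0_norm vt) mulrC ler_wpM2r ?(ltW vt)// gtr0_norm// (lt_le_trans a10).
Qed.

(** The weight of class [-1] decays like [exp(- 2 a1 u v)], and [expR_ge_sqr] weakens this to an
    inverse square, which is still integrable in [v]. *)
Lemma guidance_decay t : t < T -> 0 < u t ->
  D t * N1 t <= 2 * a2 * beta * N1 t / (a1 * (u t * v t)) ^+ 2.
Proof.
move=> tT u0; have v0 := snr_gt0 tT.
have n1 := post_mass_gt0 dp1 sp1 a12W (u t) (v t).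
have nm := post_mass_gt0 dpm1 spm1 a12N (u t) (v t).
have uv : 0 <= u t * v t by rewrite mulr_ge0 ?(ltW u0) ?(ltW v0).
have auv : 0 < a1 * (u t * v t) := mulr_gt0 a10 (mulr_gt0 u0 v0).
have /andP[_ hD] := guidance_bounds dp1 dpm1 sp1 spm1 a12W (u t) (v t).
have h1 : D t * N1 t <= 2 * a2 * Nm t.
  apply: (@le_trans _ _ (2 * a2 * (Nm t / (N1 t + Nm t)) * N1 t)).
    by rewrite ler_wpM2r// ltW.
  rewrite -mulrA ler_wpM2l ?mulr_ge0 ?(ltW a20)//.
  rewrite mulrAC ler_pdivrMr ?addr_gt0// ler_wpM2l ?(ltW nm)//.
  by rewrite lerDl ltW.
apply: (le_trans h1); rewrite -!mulrA ler_wpM2l// ler_wpM2l ?(ltW a20)//.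
have := post_mass_ub a12 beta1 dp1 dpm1 sp1 spm1 bb (ltW a10) uv (lexx _).
move=> /le_trans; apply; rewrite -!mulrA ler_wpM2l ?(ltW beta0)// mulrC.
rewrite ler_wpM2l ?(ltW n1)// expRN lef_pV2 ?posrE ?expR_gt0 ?exprn_gt0//.
exact: expR_ge_sqr (ltW auv).
Qed.

(** Gronwall in the variable [v]: from some time on [- dS/dv <= (C / v^2) S], hence
    [S * expR (- C / v)] is nondecreasing and bounds [S] from below. *)
Lemma exceedance_lb : exists2 c, 0 < c & forall t, 0 < t < T -> c <= S t.
Proof.
have h0 := T0; have h1 := a10.
pose s := T / 2; have s0 : 0 < s by rewrite /s; lra.
have sT : s < T by rewrite /s; lra.
(* Once [v t >= K], the growth [u t >= u s + a1 (v t - v s)] gives [u t >= a1 v t / 2]. *)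
pose K := Num.max 1 (2 * v s - 2 * u s / a1).
have K1 : 1 <= K by rewrite le_max lexx.
have [t2 /andP[t20 t2T] ht2] := snr_large T0 K1.
pose C := w * (2 * a2 * beta) * expR (3 / 2) * ((4 + 4 * a2 + 2 * a1) / a1 ^+ 4).
have C0 : 0 <= C.
  have : 0 < expR (3 / 2 : R) by exact: expR_gt0.
  by move=> e0; rewrite /C !mulr_ge0 ?invr_ge0 ?exprn_ge0 ?addr_ge0 ?mulr_ge0// ltW.
pose m := Num.max s t2.
have mT : m < T by rewrite /m gt_max sT.
have m0 : 0 < m by rewrite /m lt_max s0.
have late t : m <= t -> t < T -> 1 <= v t /\ a1 / 2 * v t <= u t.
  rewrite /m ge_max => /andP[st t2t] tT.
  have := ht2 t; rewrite t2t tT /K ge_max => /(_ isT) /andP[v1 v2]; split => //.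
  apply: le_trans (scaled_growth_a1 (ltW s0) st tT).
  have : a1 * (2 * v s - 2 * u s / a1) <= a1 * v t by rewrite ler_wpM2l// ltW.
  have -> : a1 * (2 * v s - 2 * u s / a1) = 2 * a1 * v s - 2 * u s by field; rewrite gt_eqF.
  by lra.
have rate t : m <= t -> t < T -> w * D t * N1 t <= C / v t ^+ 2 * S t.
  move=> mt tT; have [v1 uv] := late _ mt tT.
  have v0 := snr_gt0 tT.
  have u0 : 0 < u t by apply: lt_le_trans uv; rewrite mulr_gt0//; lra.
  have ua : a1 <= 2 * u t by nra.
  have S0 := exceedance_gt0 t.
  have e0 : 0 < expR (3 / 2 : R) by exact: expR_gt0.
  rewrite -mulrA; apply: (@le_trans _ _ (w * (2 * a2 * beta * N1 t / (a1 * (u t * v t)) ^+ 2))).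
    by rewrite ler_wpM2l ?(ltW w0)// guidance_decay.
  apply: (@le_trans _ _ (w * (2 * a2 * beta * (expR (3 / 2) * (1 + a2 * v t + u t) * S t)
       / (a1 * (u t * v t)) ^+ 2))).
    rewrite ler_wpM2l ?(ltW w0)// ler_wpM2r ?invr_ge0 ?sqr_ge0//.
    rewrite ler_wpM2l ?mulr_ge0 ?(ltW a20) ?(ltW beta0)//.
    exact/post_mass_le_exceedance/ltW.
  rewrite /C [leRHS](_ : _ = w * (2 * a2 * beta) * expR (3 / 2) * S t / v t ^+ 2 *
    ((4 + 4 * a2 + 2 * a1) / a1 ^+ 4)); last by ring.
  rewrite [leLHS](_ : _ = w * (2 * a2 * beta) * expR (3 / 2) * S t / v t ^+ 2 *
    ((1 + a2 * v t + u t) / (a1 * u t) ^+ 2)); last by field; rewrite !gt_eqF.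
  rewrite ler_wpM2l//.
    by rewrite !mulr_ge0 ?invr_ge0 ?sqr_ge0// ltW.
  rewrite ler_pdivrMr ?exprn_gt0 ?mulr_gt0//.
  rewrite (_ : _ * (a1 * u t) ^+ 2 = (4 + 4 * a2 + 2 * a1) * (u t / a1) ^+ 2); last first.
    by field; rewrite gt_eqF.
  (* From [z >= 1/2] and [v <= 2 z] one gets [1 <= 4 z^2], [a2 v <= 4 a2 z^2] and [u <= 2 a1 z^2],
     the three terms of the constant in [C]. *)
  set z := u t / a1; have uz : u t = z * a1 by rewrite /z; field; rewrite gt_eqF.
  have z1 : 1 <= 2 * z by rewrite /z mulrA ler_pdivlMr// mul1r.
  have vz : v t <= 2 * z.
    by rewrite /z mulrA ler_pdivlMr//; lra.
  have a2v : a2 * v t <= a2 * (4 * z ^+ 2) by rewrite ler_wpM2l ?(ltW a20)//; nra.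
  have a1z : a1 * z <= a1 * (2 * z ^+ 2) by rewrite ler_wpM2l ?(ltW a10)//; nra.
  rewrite uz; nra.
pose W t := S t * expR (- C / v t).
have W_ge t : m <= t -> t < T -> W m <= W t.
  move=> mt tT.
  have dW r : m <= r -> r < T -> is_derive r 1 W (v r / b_ T r ^+ 2 * expR (- C / v r) *
      (C / v r ^+ 2 * S r - w * D r * N1 r)).
    move=> mr rT; have r0 : 0 < r < T by rewrite rT (lt_le_trans m0).
    have d1 := is_derive_exceedance r0.
    have d2 := is_derive_snr rT.
    have vn : v r != 0 by rewrite gt_eqF ?snr_gt0.
    have bn : b_ T r != 0 by rewrite gt_eqF ?b_gt0.
    have d3 := is_deriveV vn d2.
    rewrite /W; apply: is_derive_eq; rewrite /GRing.scale/=; field.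
    by rewrite vn bn.
  apply: (is_derive_ge0_le mt).
  - apply: continuous_in_subspaceT => z; rewrite inE/= in_itv/= => /andP[mz zt].
    apply/differentiable_continuous/derivable1_diffP.
    by case: (dW z mz (le_lt_trans zt tT)).
  - by move=> r /andP[/ltW mr rt]; apply: dW => //; exact: lt_trans tT.
  - move=> r /andP[/ltW mr rt]; have rT := lt_trans rt tT.
    rewrite mulr_ge0 ?subr_ge0 ?rate// mulr_ge0 ?expR_ge0//.
    exact/ltW/snr_rate_gt0.
exists (W m); first by rewrite mulr_gt0 ?expR_gt0 ?exceedance_gt0.
have WS t : t < T -> W t <= S t.
  move=> tT; rewrite ler_piMr ?(ltW (exceedance_gt0 _))// -[leRHS]expR0 ler_expR.
  by rewrite mulNr oppr_le0 divr_ge0// ltW// snr_gt0.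
move=> t /andP[t0 tT]; have [tm|/ltW mt] := leP t m.
  by apply: le_trans (exceedance_decr t0 tm mT); exact: WS.
by apply: le_trans (WS _ tT); exact: W_ge.
Qed.

End trajectory.

(** * Convergence of the trajectory *)

Lemma gcdf_tails {R : realType} (e : R) : 0 < e ->
  exists2 Z, 0 < Z & gcdf (- Z) < e /\ 1 - e < gcdf Z.
Proof.
move=> e0; have ei : 0 < e^-1 by rewrite invr_gt0.
have Z0 : 0 < 1 + 2 * e^-1 by lra.
have h : expR (- (1 + 2 * e^-1) ^+ 2 / 2) < e.
  rewrite mulNr expRN -[ltRHS]invrK ltf_pV2 ?posrE ?expR_gt0//.
  by apply: lt_le_trans (expR_ge1Dx _); nra.
exists (1 + 2 * e^-1) => //; split.
  exact: le_lt_trans (gcdfN_le (ltW Z0)) h.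
by apply: lt_le_trans (gcdf_ge (ltW Z0)); rewrite ltrD2l ltrN2.
Qed.

Section exceedance_limit.
Context {R : realType} (p1 pm1 : R -> R) (a1 a2 beta T : R) (u v : R -> R).
Context (a12 : a1 < a2) (beta1 : 1 <= beta) (T0 : 0 < T).
Context (dp1 : is_density p1) (dpm1 : is_density pm1).
Context (sp1 : supported_on p1 a1 a2) (spm1 : supported_on pm1 (- a2) (- a1)).
Context (bb : beta_bounded pm1 p1 a1 a2 beta).
Implicit Types (s t y r e : R).

Let S t := mean p1 (fun y => gcdf (v t * y - u t)).

Context (v_gt0 : forall t, t < T -> 0 < v t).
Context (v_large : forall K, 1 <= K ->
  exists2 t0, 0 < t0 < T & forall t, t0 <= t < T -> K <= v t).
Context (S_decr : forall s t, 0 < s -> s <= t -> t < T -> S t <= S s).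
Context (S_lb : exists2 c, 0 < c & forall t, 0 < t < T -> c <= S t).
Context (S_lt1 : forall t, t < T -> S t < 1).

Let a12W : a1 <= a2. Proof. exact: ltW. Qed.
Let beta0 : 0 < beta. Proof. by apply: lt_le_trans beta1. Qed.
Let L0 : 0 < a2 - a1. Proof. by rewrite subr_gt0. Qed.
Local Notation G := (tail_mass p1).

(** As [S] is nonincreasing, its infimum [sigma] is also its limit at [T]. *)
Let A := [set S t | t in [set t | 0 < t < T]].
Let sigma := inf A.

Let mid : 0 < T / 2 < T.
Proof. by have := T0 => h; apply/andP; split; lra. Qed.

Let A0 : A !=set0. Proof. by exists (S (T / 2)); exists (T / 2). Qed.

Let A_inf : has_inf A.
Proof.
by split => //; have [c _ h] := S_lb; exists c => _ [t t0 <-]; exact: h.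
Qed.

Let sigma_le t : 0 < t < T -> sigma <= S t.
Proof. by move=> h; apply: (ge_inf (proj2 A_inf)); exists t. Qed.

Let sigma_gt0 : 0 < sigma.
Proof.
have [c c0 h] := S_lb; apply: (lt_le_trans c0); apply: lb_le_inf => //.
by move=> _ [t t0 <-]; exact: h.
Qed.

Let sigma_lt1 : sigma < 1.
Proof.
by have /andP[_ h] := mid; apply: le_lt_trans (sigma_le mid) (S_lt1 h).
Qed.

Let sigma_near e : 0 < e ->
  exists2 t0, 0 < t0 < T & forall t, t0 <= t < T -> S t < sigma + e.
Proof.
move=> e0; have [_ [t0 t0T <-] h] := inf_adherent e0 A_inf.
exists t0; first exact: t0T.
move=> t /andP[tt tT]; apply: le_lt_trans h.
by have /andP[p _] := t0T; exact: S_decr.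
Qed.

(** The limit of [u / v] will be the quantile [l] at which the tail mass of [p1] crosses [sigma]. *)
Let E := [set r | sigma <= G r].
Let l := sup E.

Let E_ub : ubound E a2.
Proof.
move=> r; rewrite /E/= => h; rewrite leNgt; apply/negP => /ltW ar.
have := tail_mass_above dp1 sp1 ar.
by move=> /(le_trans h); rewrite leNgt sigma_gt0.
Qed.

Let E_sup : has_sup E.
Proof.
split; last by exists a2.
exists (a1 - 1); rewrite /E/= (tail_mass_below dp1 sp1) ?(ltW sigma_lt1)//.
by rewrite gtrBl.
Qed.

Let G_lt r : l < r -> G r < sigma.
Proof.
move=> lr; rewrite ltNge; apply/negP => h.
by have := ub_le_sup (proj2 E_sup) h; rewrite leNgt lr.
Qed.

Let G_ge r : r < l -> sigma <= G r.
Proof.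
move=> rl; have d0 : 0 < l - r by rewrite subr_gt0.
have [r' Er' h] := sup_adherent d0 E_sup.
apply: (le_trans Er'); apply: (tail_mass_decr dp1 sp1).
by move: h; rewrite -/l => h; lra.
Qed.

Let l_ge : a1 <= l.
Proof.
rewrite leNgt; apply/negP => la.
have h1 : l < (l + a1) / 2 by lra.
have h2 : (l + a1) / 2 < a1 by lra.
have := G_lt h1; rewrite (tail_mass_below dp1 sp1 h2) => h3.
by have := lt_trans h3 sigma_lt1; rewrite ltxx.
Qed.

Let l_lt : l < a2.
Proof.
(* With this [h], [tail_mass_ub] bounds the tail mass beyond [a2 - h] by [sigma / 2]. *)
pose h := sigma * (a2 - a1) / (2 * beta).
have h0 : 0 < h by rewrite divr_gt0 ?mulr_gt0.
pose r := Num.max a1 (a2 - h).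
have ra : r < a2 by rewrite gt_max a12/= gtrBl.
apply: le_lt_trans ra; rewrite leNgt; apply/negP => /G_ge.
have ar : a1 <= r by rewrite le_max lexx.
have ra : r < a2 by rewrite gt_max a12/= gtrBl.
move=> /le_trans/(_ (tail_mass_ub a12 beta1 dp1 dpm1 sp1 spm1 bb ar ra)).
apply/negP; rewrite -ltNge.
apply: (@le_lt_trans _ _ (beta / (a2 - a1) * h)).
  rewrite ler_wpM2l ?divr_ge0 ?(ltW beta0) ?(ltW L0)// lerBlDr -lerBlDl.
  by rewrite le_max lexx orbT.
rewrite (_ : _ * h = sigma / 2); last by rewrite /h; field; rewrite !gt_eqF.
by have := sigma_gt0; lra.
Qed.

Let G_gt r : r < l -> sigma < G r.
Proof.
move=> rl; have [ra|ar] := ltP r a1.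
  by rewrite (tail_mass_below dp1 sp1 ra) sigma_lt1.
have h1 : r < (r + l) / 2 by lra.
have h2 : (r + l) / 2 < l by lra.
have h3 : (r + l) / 2 <= a2 by rewrite ltW// (lt_trans h2 l_lt).
apply: (le_lt_trans (G_ge h2)).
apply: lt_le_trans (tail_mass_gap a12 beta1 dp1 dpm1 sp1 spm1 bb ar h1 h3).
by rewrite ltrDl divr_gt0 ?mulr_gt0// subr_gt0.
Qed.

(** Either the left side is below [a1 <= l], or by [tail_mass_gap] its tail mass is at least
    [S t >= sigma], so it belongs to [E]. *)
Let l_lb t : 0 < t < T -> a2 - beta * (a2 - a1) * S t <= l.
Proof.
move=> tT; set r := a2 - _.
have [ra|ar] := ltP r a1; first exact: le_trans (ltW ra) l_ge.
have S0 : 0 < S t by apply: lt_le_trans (sigma_le tT).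
have ra : r < a2 by rewrite gtrBl !mulr_gt0.
apply: (ub_le_sup (proj2 E_sup)); rewrite /E/=; apply: (le_trans (sigma_le tT)).
apply: le_trans (tail_mass_gap a12 beta1 dp1 dpm1 sp1 spm1 bb ar ra (lexx _)).
have -> : (a2 - r) / (beta * (a2 - a1)) = S t.
  by rewrite /r; field; rewrite !gt_eqF.
rewrite lerDr; apply: (mean_ge0 dp1 sp1); first exact: bounded_on_indic.
by move=> y _; rewrite indic_ray ler0n.
Qed.

Let bg c d : bounded_on a1 a2 (fun y => gcdf (c * y - d)).
Proof. exact/(bounded_on_continuous a12W)/continuous_exceedance_kernel. Qed.

Let bi r : bounded_on a1 a2 (\1_(`]r, +oo[%classic : set R) : R -> R).
Proof. exact: bounded_on_indic. Qed.

(** Split at [r]: above it [gcdf] is at most [1], below it at most [gcdf (- Z)]. *)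
Let S_ub Z r t : (forall y, y <= r -> v t * y - u t <= - Z) ->
  S t <= G r + gcdf (- Z).
Proof.
move=> h; rewrite -[X in _ + X](mean_cst dp1) -(meanD dp1 sp1)//; last exact: bounded_on_cst.
apply: (mean_le dp1 sp1) => //.
  by apply: bounded_onD => //; exact: bounded_on_cst.
move=> y _; rewrite indic_ray; case: ltP => [_|/h yr].
  by rewrite ler_wpDr ?gcdf_ge0// gcdf_le1.
by rewrite add0r gcdf_le.
Qed.

Let S_lb_tail Z r t : (forall y, r < y -> Z <= v t * y - u t) ->
  G r + (gcdf Z - 1) <= S t.
Proof.
move=> h; rewrite -[X in _ + X](mean_cst dp1) -(meanD dp1 sp1)//; last exact: bounded_on_cst.
apply: (mean_le dp1 sp1) => //.
  by apply: bounded_onD => //; exact: bounded_on_cst.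
move=> y _; rewrite indic_ray; case: ltP => [/h yr|_].
  by rewrite addrCA subrr addr0 gcdf_le.
by rewrite add0r (le_trans _ (gcdf_ge0 _))// subr_le0 gcdf_le1.
Qed.

Let v_eventually c Z : 0 < c -> exists2 t0, 0 < t0 < T &
  forall t, t0 <= t < T -> Z <= v t * c.
Proof.
move=> c0; have K1 : 1 <= Num.max 1 (Z / c) by rewrite le_max lexx.
have [t0 t0T h] := v_large K1; exists t0 => // t /h.
by rewrite ge_max => /andP[_]; rewrite ler_pdivrMr.
Qed.

(** If [u / v >= l + e] with [v] large, the mass of [X_0] below [l + e / 2] contributes almost
    nothing to [S], so [S] would fall below its infimum [sigma]. *)
Let ratio_lt e : 0 < e -> exists2 t0, 0 < t0 < T &
  forall t, t0 <= t < T -> u t / v t < l + e.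
Proof.
move=> e0.
have d0 : 0 < sigma - G (l + e / 2) by rewrite subr_gt0 G_lt// ltrDl; lra.
have [Z Z0 [hZ _]] := gcdf_tails d0.
have e20 : 0 < e / 2 by lra.
have [t0 t0T h] := v_eventually Z e20; exists t0 => // t /[dup] /h vZ /andP[tt tT].
have tT0 : 0 < t < T by rewrite tT andbT; move: t0T => /andP[/lt_le_trans -> //].
rewrite ltNge; apply/negP; rewrite ler_pdivlMr ?v_gt0// => hu.
have := sigma_le tT0; rewrite leNgt => /negP; apply.
apply: (@le_lt_trans _ _ (G (l + e / 2) + gcdf (- Z))); last by lra.
apply: S_ub => y yr; have vt := v_gt0 tT.
have : v t * y <= v t * (l + e / 2) by rewrite ler_wpM2l// ltW.
by lra.
Qed.

Let ratio_gt e : 0 < e -> exists2 t0, 0 < t0 < T &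
  forall t, t0 <= t < T -> l - e < u t / v t.
Proof.
move=> e0.
(* Half of the gap pays for the Gaussian tail, the other half for the distance from [S t] to
   [sigma]. *)
have d0 : 0 < (G (l - e / 2) - sigma) / 2.
  by rewrite divr_gt0// subr_gt0 G_gt// gtrBl; lra.
have [Z Z0 [_ hZ]] := gcdf_tails d0.
have e20 : 0 < e / 2 by lra.
have [t0 t0T h] := v_eventually Z e20.
have [t1 t1T h1] := sigma_near d0.
exists (Num.max t0 t1).
  by move: t0T t1T => /andP[p q] /andP[p' q']; rewrite lt_max p/= gt_max q.
move=> t; rewrite ge_max -andbA => /and3P[tt0 tt1 tT].
have {}h : Z <= v t * (e / 2) by apply: h; rewrite tt0.
have {}h1 : S t < sigma + (G (l - e / 2) - sigma) / 2 by apply: h1; rewrite tt1.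
rewrite ltNge; apply/negP; rewrite ler_pdivrMr ?v_gt0// => hu.
suff : G (l - e / 2) + (gcdf Z - 1) <= S t by lra.
apply: S_lb_tail => y yr; have vt := v_gt0 tT.
have : v t * (l - e / 2) <= v t * y by rewrite ler_wpM2l// ltW.
by lra.
Qed.

Lemma exceedance_limit : exists l : R,
  [/\ u t / v t @[t --> T^'-] --> l, a1 <= l, l < a2 &
      forall t, 0 < t < T -> a2 - beta * (a2 - a1) * S t <= l].
Proof.
exists l; split; [|exact: l_ge|exact: l_lt|exact: l_lb].
apply/cvgrPdist_le => e e0.
have [t0 /andP[_ t0T] h0] := ratio_lt e0.
have [t1 /andP[_ t1T] h1] := ratio_gt e0.
near=> t.
have tT : t < T by near: t; exact: nbhs_left_lt.
have tt0 : t0 <= t by near: t; exact: nbhs_left_ge.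
have tt1 : t1 <= t by near: t; exact: nbhs_left_ge.
have := h0 t; rewrite tt0 tT => /(_ isT) i0.
have := h1 t; rewrite tt1 tT => /(_ isT) i1.
by rewrite ler_norml; apply/andP; split; lra.
Unshelve. all: by end_near. Qed.

End exceedance_limit.

(** * Reaching a high level early *)

Lemma normal_prob_right_tail {R : realType} (c : R) : 0 <= c ->
  ((1 - expR (- c ^+ 2 / 2))%:E <= normal_prob 0 1 `](- c)%R, +oo[%classic)%E.
Proof.
move=> c0; have -> : [set` `]- c, +oo[] = ~` [set` `]-oo, - c]] :> set R by rewrite setCitvl.
rewrite probability_setC// EFinB leeB//.
rewrite -[c ^+ 2]sqrrN normal_prob_chernoff// => y /=.
by rewrite in_itv /= => yc; nra.
Qed.

Section level.
Context {R : realType} (p1 pm1 : R -> R) (a1 a2 beta T w : R) (x : R -> R).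
Context (a10 : 0 < a1) (a12 : a1 < a2) (beta1 : 1 <= beta) (w1 : 1 <= w).
Context (dp1 : is_density p1) (dpm1 : is_density pm1).
Context (sp1 : supported_on p1 a1 a2) (spm1 : supported_on pm1 (- a2) (- a1)).
Context (bb : beta_bounded pm1 p1 a1 a2 beta).
Context (cx : {within `[0, T[, continuous x}).
Context (dx : forall t : R, 0 < t < T -> is_derive t 1 x (guided_field p1 pm1 T w t (x t))).
Context (T2 : 2 * ln 2 <= T).
Context (lnw : ln w / (16 * Num.sqrt w) <= a1 * a2 / beta).
Context (x0 : - (a1 * Num.sqrt w / (16 * beta)) <= x 0).

(* Chosen so that [a = 12/13], [b = 5/13] and [a / b] are rational. *)
Let t1 := T + ln (12 / 13).

Let ln2_gt0 : 0 < ln 2 :> R.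
Proof. by rewrite ln_gt0// ltr1n. Qed.

Lemma T_gt0 : 0 < T.
Proof. by apply: lt_le_trans T2; rewrite mulr_gt0. Qed.

Let t1_lt : t1 < T.
Proof. by rewrite /t1 gtrDl ln_lt0//; apply/andP; split; lra. Qed.

Let t1_gt0 : 0 < t1.
Proof.
have : - ln 2 < ln (12 / 13) :> R by rewrite -lnV ?posrE// ltr_ln ?posrE; lra.
by have := T2; have := ln2_gt0; rewrite /t1; lra.
Qed.

Let a_t1 : a_ T t1 = 12 / 13.
Proof. by rewrite /a_ /t1 addrAC subrr add0r lnK// posrE; lra. Qed.

Let snr_t1 : snr T t1 = 12 / 5.
Proof.
rewrite /snr; have -> : b_ T t1 = 5 / 13.
  rewrite /b_ a_t1 (_ : 1 - _ = (5 / 13) ^+ 2); last by field.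
  by rewrite sqrtr_sqr ger0_norm//; lra.
by rewrite a_t1; field.
Qed.

Let a_0 : a_ T 0 <= 4^-1.
Proof.
apply: (@le_trans _ _ (expR (- (2 * ln 2)))).
  by rewrite /a_ sub0r ler_expR lerN2.
rewrite expRN mulrC expRM_natr lnK ?posrE//.
by rewrite lef_pV2 ?posrE//; lra.
Qed.

Let b_0 : 96 / 100 <= b_ T 0.
Proof.
have T0 := T_gt0; have a0 := a_gt0 T 0; have ha := a_0.
have b0 := b_gt0 T0; have e := b_sqr T0.
by nra.
Qed.

(** By contradiction: if [u] is below [U] at [t1], monotonicity keeps [u v <= m] before [t1], so the
    speed is at least [q] throughout. Then [u] gains at least [q (12/5 - 27/100)] from a start at or
    above [- q / 15], which exceeds [5 q / 3 >= U]. *)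
Lemma scaled_level : exists2 t, 0 < t < T &
  snr T t = 12 / 5 /\ 5 * ln w / (48 * a2) <= scaled T x t.
Proof.
have T0 := T_gt0; have tT := t1_lt; have t0 := t1_gt0.
exists t1; first by rewrite t0.
split=> //; rewrite leNgt; apply/negP => uU.
have h10 := a10; have h12 := a12; have hb1 := beta1; have hw1 := w1.
have w0 : 0 < w by lra.
have a20 : 0 < a2 by lra.
have b0 : 0 < beta by lra.
pose s := Num.sqrt w.
have s0 : 0 < s by rewrite sqrtr_gt0.
have s2 : s ^+ 2 = w by rewrite sqr_sqrtr// ltW.
have s1 : 1 <= s by rewrite -sqrtr1 ler_wsqrtr.
have lw0 : 0 <= ln w by rewrite ln_ge0.
have lws : ln w = ln s *+ 2 by rewrite -s2 lnXn.
pose q := a1 * s / beta.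
have q0 : 0 < q by rewrite divr_gt0// mulr_gt0.
set U := 5 * ln w / (48 * a2) in uU.
(* This is the first hypothesis on [w], in the form [ln w <= 16 s a1 a2 / beta]. *)
have Uq : U <= 5 / 3 * q.
  move: lnw; rewrite -/s ler_pdivrMr ?mulr_gt0// => h.
  rewrite /U ler_pdivrMr ?mulr_gt0// (_ : 5 / 3 * q * _ = 5 * (a1 * a2 / beta * (16 * s))).
    by lra.
  by rewrite /q; field; rewrite gt_eqF.
pose m := ln w / (4 * a2).
have m0 : 0 <= m by rewrite divr_ge0// ltW// mulr_gt0.
have Um : U * (12 / 5) = m by rewrite /U /m; field; rewrite gt_eqF.
have speedq r : 0 < r < t1 -> q <= speed p1 pm1 T w x r.
  move=> /andP[r0 rt]; have rT := lt_trans rt tT.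
  have vr0 := snr_gt0 rT.
  have vr : snr T r <= 12 / 5 by rewrite -snr_t1 snr_le// ltW.
  have ur : scaled T x r < U.
    apply: le_lt_trans uU; apply: (scaled_le a10 a12 _ dp1 dpm1 sp1 spm1 cx dx) => //; exact: ltW.
  have uv : scaled T x r * snr T r <= m.
    rewrite -Um; have [u0|/ltW u0] := leP 0 (scaled T x r).
      by rewrite ler_pM// ?(ltW vr0) ?(ltW ur).
    apply: (@le_trans _ _ 0); first by rewrite mulr_le0_ge0// ltW.
    by rewrite Um.
  have := post_mass_lb a12 beta1 dp1 dpm1 sp1 spm1 bb (ltW a10) m0 uv.
  have n1 := post_mass_gt0 dp1 sp1 (ltW a12) (scaled T x r) (snr T r).
  have a12N : - a2 <= - a1 by rewrite lerN2 ltW.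
  have nm := post_mass_gt0 dpm1 spm1 a12N (scaled T x r) (snr T r).
  (* [m] is chosen so that the exponential loss in [post_mass_lb] is exactly [1 / sqrt w]. *)
  have -> : 2 * a2 * m = ln s by rewrite /m lws; field; rewrite gt_eqF.
  rewrite expRN lnK ?posrE// ler_pdivrMl// => hN.
  apply: le_trans (speed_ge pm1 _ _ _ a12 dp1 sp1 _).
  have := guidance_ge T x a12 dp1 dpm1 sp1 spm1 r.
  move: n1 nm hN; set N := post_mass p1 _ _; set N' := post_mass pm1 _ _ => n1 nm hN hD.
  (* Both [N] and [N'] are at most [s * beta * N']. *)
  have hc : (2 * (s * beta))^-1 <= N' / (N + N').
    rewrite ler_pdivlMr ?addr_gt0// ler_pdivrMl ?mulr_gt0//.
    have : 1 * N' <= s * beta * N' by rewrite ler_wpM2r ?(ltW nm)//; nra.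
    by lra.
  have : w * (2 * a1 * (2 * (s * beta))^-1) <= w * guidance p1 pm1 (scaled T x r) (snr T r).
    rewrite ler_wpM2l ?(ltW w0)//; apply: le_trans hD.
    by rewrite ler_wpM2l// mulr_ge0// ltW.
  have -> : w * (2 * a1 * (2 * (s * beta))^-1) = q.
    by rewrite /q -s2; field; rewrite !gt_eqF.
  by lra.
have := scaled_growth a12 dp1 dpm1 sp1 spm1 cx dx (lexx 0) (ltW t0) tT speedq.
rewrite snr_t1 => hu.
have bb0 := b_0; have b00 : 0 < b_ T 0 by lra.
have v0 : snr T 0 <= 27 / 100.
  by rewrite /snr ler_pdivrMr//; have := a_0; lra.
have u0 : - (q / 15) <= scaled T x 0.
  rewrite scaledE ler_pdivlMr//; apply: le_trans x0.
  rewrite -/s (_ : a1 * s / (16 * beta) = q / 16); last by rewrite /q; field; rewrite gt_eqF.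
  by nra.
have : q * (12 / 5 - 27 / 100) <= q * (12 / 5 - snr T 0) by rewrite ler_wpM2l ?(ltW q0)//; lra.
by lra.
Qed.

End level.

(** * Limit of the output sample and conclusion *)

Lemma guided_limit {R : realType} (p1 pm1 : R -> R) (a1 a2 beta T w : R) (x : R -> R) :
  0 < a1 -> a1 < a2 -> 1 <= beta -> 0 < T -> 0 < w ->
  is_density p1 -> is_density pm1 ->
  supported_on p1 a1 a2 -> supported_on pm1 (- a2) (- a1) ->
  beta_bounded pm1 p1 a1 a2 beta ->
  {within `[0, T[, continuous x} ->
  (forall t : R, 0 < t < T -> is_derive t 1 x (guided_field p1 pm1 T w t (x t))) ->
  exists l : R, [/\ x t @[t --> T^'-] --> l, a1 <= l, l < a2 &
    forall t, 0 < t < T -> a2 - beta * (a2 - a1) * exceedance p1 T x t <= l].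
Proof.
move=> a10 a12 beta1 T0 w0 dp1 dpm1 sp1 spm1 bb cx dx.
have [l [cl l1 l2 hl]] := exceedance_limit a12 beta1 T0 dp1 dpm1 sp1 spm1 bb
  (@snr_gt0 _ T) (fun K => @snr_large _ T K T0)
  (exceedance_decr a10 a12 w0 dp1 dpm1 sp1 spm1 dx)
  (exceedance_lb a10 a12 beta1 T0 w0 dp1 dpm1 sp1 spm1 bb cx dx)
  (@exceedance_lt1 _ _ _ _ T x a12 dp1 sp1).
exists l; split => //.
have ca : a_ T t @[t --> T^'-] --> (1 : R).
  have -> : (1 : R) = a_ T T by rewrite /a_ subrr expR0.
  apply: cvg_at_left_filter; apply/differentiable_continuous/derivable1_diffP.
  by case: (is_derive_a T T).
(* Before [T] this product equals [x t], and [a_ T t] tends to [1]. *)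
have h : (a_ T \* (fun t => scaled T x t / snr T t)) t @[t --> T^'-] --> l.
  by rewrite -[l]mul1r; exact: cvgM ca cl.
suff e : {near T^'-, (a_ T \* (fun t => scaled T x t / snr T t)) =1 x}.
  by apply: cvg_trans h; exact: near_eq_cvg e.
near=> t.
have tT : t < T by near: t; exact: nbhs_left_lt.
have bn : b_ T t != 0 by rewrite gt_eqF ?b_gt0.
have an : a_ T t != 0 by rewrite gt_eqF ?a_gt0.
by rewrite scaledE /snr /=; field; rewrite bn an.
Unshelve. all: by end_near. Qed.

Lemma expR1_le4 {R : realType} : expR 1 <= 4 :> R.
Proof.
have := expR_ge1Dx (- 2^-1 : R); rewrite expRN => h.
have e0 : 0 < expR (2^-1 : R) by exact: expR_gt0.
have h2 : expR (2^-1 : R) <= 2.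
  by rewrite -[leRHS]invrK -[leLHS]invrK lef_pV2 ?posrE ?invr_gt0//; lra.
have -> : (1 : R) = 2^-1 + 2^-1 by lra.
by rewrite expRD; nra.
Qed.

Theorem theorem3p1 (R : realType) (a1 a2 beta T w : R)
  (p1 pm1 : R -> R) (xs : R -> R -> R) :
  0 < a1 -> a1 < a2 -> 1 <= beta ->
  is_density p1 -> is_density pm1 ->
  supported_on p1 a1 a2 -> supported_on pm1 (- a2) (- a1) ->
  beta_bounded pm1 p1 a1 a2 beta ->
  2 * ln 2 <= T ->
  expR 1 < w ->
  ln w / (16 * Num.sqrt w) <= a1 * a2 / beta ->
  1024 * (a2 / Num.min a1 1) ^+ 2 <= ln w / ln (ln w) ->
  guided_flow p1 pm1 T w xs ->
  exists A : set R,
    measurable A /\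
    A `<=` [set x0 | exists l : R,
                 xs x0 t @[t --> T^'-] --> l /\
                 a2 * (1 - 32 / Num.sqrt (ln w)) < l < a2] /\
    ((1 - expR (- (w * a1 ^+ 2) / (512 * beta ^+ 2)))%:E
       <= normal_prob 0 1 A)%E.
Proof.
move=> a10 a12 beta1 dp1 dpm1 sp1 spm1 bb T2 we lnw lnlnw flow.
have T0 := T_gt0 T2.
have b0 : 0 < beta by lra.
have a20 : 0 < a2 by lra.
have w1 : 1 <= w by rewrite (le_trans _ (ltW we))// -[leLHS]expR0 ler_expR.
have w0 : 0 < w by lra.
pose s := Num.sqrt w.
have s0 : 0 < s by rewrite sqrtr_gt0.
have s2 : s ^+ 2 = w by rewrite sqr_sqrtr// ltW.
(* The good event is [x(0) > - c]; here [c^2 / 2] is the exponent in the stated probability, and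
   [- c] is the start allowed by [scaled_level]. *)
pose c := a1 * s / (16 * beta).
have c0 : 0 < c by rewrite divr_gt0 ?mulr_gt0.
exists `]- c, +oo[%classic; split => //; split; last first.
  have -> : - (w * a1 ^+ 2) / (512 * beta ^+ 2) = - c ^+ 2 / 2.
    by rewrite /c -s2; field; rewrite gt_eqF.
  exact/normal_prob_right_tail/ltW.
move=> x0 /=; rewrite in_itv /= andbT => cx0.
have [x00 [cx dx]] := flow x0.
have [l [cl l1 l2 hl]] := guided_limit a10 a12 beta1 T0 w0 dp1 dpm1 sp1 spm1 bb cx dx.
exists l; split => //; rewrite l2 andbT.
set lam := ln w in lnw lnlnw *.
have lam1 : 1 < lam by rewrite /lam -ltr_expR lnK.
have sl0 : 0 < Num.sqrt lam by rewrite sqrtr_gt0; lra.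
have sl2 : Num.sqrt lam ^+ 2 = lam by rewrite sqr_sqrtr//; lra.
(* For [sqrt lam < 32] the lower end is negative, whereas [l >= a1 > 0]. *)
have [small|big] := ltP lam 1024.
  apply: (@lt_le_trans _ _ 0); last by lra.
  rewrite pmulr_rlt0// subr_lt0 ltr_pdivlMr// mul1r.
  by nra.
have lnlam : 1 <= ln lam.
  rewrite -ler_expR lnK ?posrE; last by lra.
  by apply: (le_trans expR1_le4); lra.
(* The second hypothesis on [w], weakened by [ln lam >= 1] and [min a1 1 <= 1]. *)
have a2lam : 1024 * a2 ^+ 2 <= lam.
  have m0 : 0 < Num.min a1 1 by rewrite lt_min a10 ltr01.
  have m1 : Num.min a1 1 <= 1 by rewrite ge_min lexx orbT.
  apply: (@le_trans _ _ (1024 * (a2 / Num.min a1 1) ^+ 2)).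
    rewrite ler_wpM2l ?ler0n// ler_pXn2r ?nnegrE ?divr_ge0 ?(ltW a20) ?(ltW m0)//.
    by rewrite ler_pdivlMr// ler_piMr// ltW.
  apply: (le_trans lnlnw); rewrite ler_pdivrMr; last by lra.
  by rewrite ler_peMr//; lra.
clear lnlnw big.
have x00c : - (a1 * Num.sqrt w / (16 * beta)) <= xs x0 0 by rewrite x00 ltW.
have [t tT [vt ut]] := scaled_level a10 a12 beta1 w1 dp1 dpm1 sp1 spm1 bb cx dx T2 lnw x00c.
rewrite -/lam in ut.
have es : expR (lam / 2) = s.
  have -> : lam / 2 = ln s by rewrite /lam -s2 lnXn//; field.
  by rewrite lnK ?posrE.
(* The first hypothesis gives [lam * beta <= 16 a1 a2 s], and [a1 a2 <= a2^2 <= lam / 1024]. *)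
have bs : beta <= s.
  move: lnw; rewrite -/s ler_pdivrMr ?mulr_gt0// => h.
  have : lam * beta <= a1 * a2 * (16 * s).
    move: h; rewrite (_ : a1 * a2 / beta * (16 * s) = a1 * a2 * (16 * s) / beta); last by ring.
    by rewrite ler_pdivlMr.
  have : a1 * a2 * (16 * s) <= lam / 64 * s.
    by rewrite [16 * s]mulrC mulrCA mulrA [s * _]mulrC mulrAC ler_wpM2r ?(ltW s0)//; nra.
  move=> h1 h2; have : lam * beta <= lam * (s / 64) by lra.
  by rewrite ler_pM2l; lra.
have S_le : exceedance p1 T (xs x0) t <= expR (- (5 * lam)).
  have /andP[_ tT'] := tT.
  apply: (le_trans (exceedance_le _ a12 dp1 sp1 tT')).
  (* The level [5 lam / (48 a2)] exceeds [12/5 a2] by at least [z] because [576 a2^2 <= lam], and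
     [z^2 / 2 >= 5 lam] because [1000 a2^2 <= lam]. *)
  set z := lam / (10 * a2).
  have z0 : 0 <= z by rewrite divr_ge0 ?mulr_ge0//; lra.
  have hz : snr T t * a2 - scaled T (xs x0) t <= - z.
    suff : 12 / 5 * a2 + z <= 5 * lam / (48 * a2) by rewrite vt; lra.
    rewrite ler_pdivlMr ?mulr_gt0// (_ : _ * (48 * a2) = 576 / 5 * a2 ^+ 2 + 24 / 5 * lam).
      by lra.
    by rewrite /z; field; rewrite gt_eqF.
  apply: (le_trans (gcdf_le hz)); apply: (le_trans (gcdfN_le z0)).
  rewrite ler_expR mulNr lerN2 /z.
  rewrite (_ : (lam / (10 * a2)) ^+ 2 / 2 = lam ^+ 2 / (200 * a2 ^+ 2)); last first.
    by field; rewrite gt_eqF.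
  rewrite ler_pdivlMr ?mulr_gt0 ?exprn_gt0//.
  by nra.
have el0 : 0 < expR (- lam) by exact: expR_gt0.
have el : expR (- lam) < 32 / Num.sqrt lam.
  rewrite expRN ltr_pdivlMr// ltr_pdivrMl ?expR_gt0//.
  have := expR_ge1Dx lam; have : Num.sqrt lam <= lam by nra.
  by lra.
apply: lt_le_trans (hl t tT).
have S0 := exceedance_gt0 T (xs x0) a12 dp1 sp1 t.
suff : beta * (a2 - a1) * exceedance p1 T (xs x0) t <= a2 * expR (- lam).
  have : a2 * expR (- lam) < a2 * (32 / Num.sqrt lam) by rewrite ltr_pM2l.
  by lra.
apply: (@le_trans _ _ (s * a2 * expR (- (5 * lam)))).
  apply: ler_pM => //.
  - by rewrite mulr_ge0 ?(ltW b0)//; lra.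
  - exact: ltW.
  - by rewrite ler_pM ?(ltW b0) ?subr_ge0 ?(ltW a12)// gerBl ltW.
(* The factor [beta] was absorbed into [s = expR (lam / 2)], and [lam / 2 - 5 lam <= - lam]. *)
rewrite -es [_ * a2]mulrC -mulrA -expRD ler_pM2l// ler_expR.
by lra.
Qed.
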